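(* Let $(a_n)_{n\in\mathbb{Z}}$ be real numbers satisfying $0\ne|a_n|\le C r^{|n|}$ for all $n\in\mathbb{Z}$, for some constants $C>0$ and $0<r<1$. Then $\Lambda=\{n+a_n\}_{n\in\mathbb{Z}}$ admits a pair of generators, i.e. there exist $\varphi_1,\varphi_2\in L^1(\mathbb{R})$ such that the linear combinations of the functions $\varphi_1(t-\lambda_1)$ and $\varphi_2(t-\lambda_2)$, $\lambda_1,\lambda_2\in\Lambda$, are dense in $L^1(\mathbb{R})$. *)

(* Defs.v *)
From HB Require Import structures.
From mathcomp Require Import all_boot all_order all_algebra.
From mathcomp Require Import all_classical all_reals all_analysis.
Set Implicit Arguments. Unset Strict Implicit. Unset Printing Implicit Defensive.
Import Order.TTheory GRing.Theory Num.Theory.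
Local Open Scope ring_scope.

Definition L1 (R : realType) (f : R -> R) : Prop :=
  (@lebesgue_measure R).-integrable setT (EFin \o f).

Definition L1_dist (R : realType) (f g : R -> R) : \bar R :=
  (\int[@lebesgue_measure R]_(x in setT) (`|f x - g x|)%:E)%E.

Definition transl_comb (R : realType) (phi1 phi2 : R -> R) (lam : int -> R)
    (s : seq (R * bool * int)) : R -> R :=
  fun t => \sum_(p <- s) p.1.1 * ((if p.1.2 then phi1 else phi2) (t - lam p.2)).

Definition dense_translates (R : realType) (phi1 phi2 : R -> R) (lam : int -> R) : Prop :=
  forall g : R -> R, L1 g -> forall eps : R, 0 < eps ->
    exists s : seq (R * bool * int),
      (L1_dist g (transl_comb phi1 phi2 lam s) < eps%:E)%E.

(* Main.v *)
Require Import Defs.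
From HB Require Import structures.
From mathcomp Require Import all_boot all_order all_algebra.
From mathcomp Require Import all_classical all_reals all_analysis.
From mathcomp Require Import measurable_realfun ring lra zify.
Set Implicit Arguments.
Unset Strict Implicit.
Unset Printing Implicit Defensive.
Import Order.TTheory GRing.Theory Num.Theory.
Import numFieldNormedType.Exports.
Local Open Scope classical_set_scope.
Local Open Scope ring_scope.

(* Choose [M] with [rho = r ^ M] small, let [T] be the translation by [M], and
   use only the translates by [M n + a (M n)].  The first generator is
   [phi = W G], where [G = exp(- t ^ 2)] and [W] is a limit of polynomials in
   [T] that is divisible by every power of [1 - T] and whose image is dense in
   that of [1 - T]; the second one is built in the same way from [- T].  Let [q]
   be the distance to the span of the translates and [g_k = t ^ k G].  Since
   [exp(a ^ 2) G(t - a)] is the sum of the [(2 a) ^ k / k! g_k], induction on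
   [k] and [a n != 0] give [q (T ^ n W g_k) = O(rho ^ |n|)].  A sequence with
   this decay which is an iterated difference, at every order, of bounded
   sequences is null: two summations divide it by a factor of order [1 / rho],
   two differences multiply it by at most [4].  Hence [q] vanishes on
   [(1 - T) g_k], likewise on [(1 + T) g_k], and so on every [g_k], whose span
   is dense. *)

(** * Antidifferences of decaying sequences *)

(** Serves both for the norm and for the distance to a span. Equality modulo the closed span is
    written [q (x - y) = 0], so that no quotient space is formed. *)
Record seminorm (R : numDomainType) (E : lmodType R) := Seminorm {
  sn :> E -> R;
  snD : forall x y, sn (x + y) <= sn x + sn y;
  snZ : forall a x, sn (a *: x) = `|a| * sn x }.

Section SeminormTheory.
Context (R : realType) (E : lmodType R) (q : seminorm E).
Implicit Types x y z : E.

Lemma sn0 : q 0 = 0.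
Proof. by rewrite -(scale0r 0) snZ normr0 mul0r. Qed.

Lemma snN x : q (- x) = q x.
Proof. by rewrite -scaleN1r snZ normrN1 mul1r. Qed.

Lemma sn_ge0 x : 0 <= q x.
Proof.
have := snD q x (- x); rewrite subrr sn0 snN -mulr2n pmulrn_lge0//.
Qed.

Lemma snBC x y : q (x - y) = q (y - x).
Proof. by rewrite -snN opprB. Qed.

Lemma sn_tri y x z : q (x - z) <= q (x - y) + q (y - z).
Proof. by rewrite -(subrKA y x (- z)) ?opprK; exact: snD. Qed.

Lemma snB x y : q (x - y) <= q x + q y.
Proof. by rewrite -(snN y); exact: snD. Qed.

Lemma sn_le_add y x : q x <= q y + q (x - y).
Proof. by rewrite -{1}(subrKC y x); exact: snD. Qed.

Lemma sn_le_of_null y x : q (x - y) = 0 -> q x <= q y.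
Proof. by move=> h; have := sn_le_add y x; rewrite h addr0. Qed.

Lemma sn_eq_of_null y x : q (x - y) = 0 -> q x = q y.
Proof.
by move=> h; apply/eqP; rewrite eq_le !sn_le_of_null// snBC.
Qed.

Lemma sn_eq0 x : q x <= 0 -> q x = 0.
Proof. by move=> h; apply/eqP; rewrite eq_le h sn_ge0. Qed.

Lemma sn_sum n (f : nat -> E) :
  q (\sum_(i < n) f i) <= \sum_(i < n) q (f i).
Proof.
elim: n => [|n IH]; first by rewrite !big_ord0 sn0.
by rewrite !big_ord_recr/=; apply: le_trans (snD _ _ _) _; rewrite lerD2r.
Qed.

End SeminormTheory.

(** Archimedean property: divide by [K] and let it grow. *)
Lemma le_of_natmul_bounded (R : realType) (a b D : R) :
  (forall K : nat, K%:R * a <= K%:R * b + D) -> a <= b.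
Proof.
move=> h; rewrite leNgt; apply/negP => ab.
have d0 : 0 < a - b by rewrite subr_gt0.
have D0 : 0 <= D by have := h 0; rewrite !mul0r add0r.
have := h (Num.truncn (D / (a - b))).+1.
rewrite -lerBlDl -mulrBr -ler_pdivlMr// leNgt.
by rewrite truncnS_gt.
Qed.

Lemma geo_vanish (R : realType) (a c k : R) :
  0 <= k -> k < 1 -> (forall m : nat, a <= c * k ^+ m) -> a <= 0.
Proof.
move=> k0 k1 h.
have cv : (fun m => c * k ^+ m) @ \oo --> c * 0.
  by apply: cvgMr => //; apply: cvg_expr; rewrite ger0_norm.
rewrite mulr0 in cv; rewrite -(cvg_lim (@Rhausdorff R) cv).
apply: limr_ge; first by apply/cvg_ex; exists 0.
by apply: nearW => m; exact: h.
Qed.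

Section FlatChain.
Context (R : realType) (E : lmodType R) (q : seminorm E).
Variables (rho : R) (rho0 : 0 <= rho) (rho1 : rho < 1).

(* If [x = y - y(. + 1)] decays to the right, then [y] converges at [+oo]; as
   [y] is itself the difference of a bounded sequence, its limit is zero. *)
Lemma antidifference_right (x y w : int -> E) (C D : R) (n : int) :
  (forall m, q (x m - (y m - y (m + 1))) = 0) ->
  (forall m, q (y m - (w m - w (m + 1))) = 0) ->
  (forall m, q (w m) <= D) ->
  0 <= C -> (forall i : nat, q (x (n + i%:Z)) <= C * rho ^+ i) ->
  q (y n) <= C / (1 - rho).
Proof.
move=> hx hy hD C0 hC.
have r1 : 0 < 1 - rho by rewrite subr_gt0.
have step (L : nat) : q (y n - y (n + L%:Z)) <= C * (1 - rho ^+ L) / (1 - rho).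
  elim: L => [|L IH]; first by rewrite addr0 subrr sn0 expr0 subrr mulr0 mul0r.
  apply: le_trans (sn_tri _ (y (n + L%:Z)) _ _) _.
  apply: le_trans (lerD IH (_ : _ <= C * rho ^+ L)) _.
    apply: le_trans (hC L); apply: sn_le_of_null; rewrite snBC.
    by rewrite -(hx (n + L%:Z)); congr (q (_ - (_ - y _))); lia.
  rewrite le_eqVlt; apply/orP; left; apply/eqP; rewrite exprS.
  by field; rewrite gt_eqF.
have step' (L : nat) : q (y n - y (n + L%:Z)) <= C / (1 - rho).
  apply: le_trans (step L) _; rewrite ler_pM2r ?invr_gt0//.
  by rewrite ler_piMr// lerBlDr lerDl exprn_ge0.
(* The limit of [y] is avoided by averaging. By [step'], [K] times [y n] is within
   [K * (C / (1 - rho))] of the sum of [K] consecutive values of [y]; that sum telescopes to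
   [w n - w (n + K)], which is at most [2 D] whatever [K] is. *)
apply: (@le_of_natmul_bounded _ _ _ (D + D)) => K.
have : q (K%:R *: y n - (w n - w (n + K%:Z))) <= K%:R * (C / (1 - rho)).
  elim: K => [|K IH]; first by rewrite scale0r addr0 subrr subr0 sn0 mul0r.
  have -> : K.+1%:R *: y n - (w n - w (n + K.+1%:Z)) =
     (K%:R *: y n - (w n - w (n + K%:Z))) + ((y n - y (n + K%:Z)) +
       (y (n + K%:Z) - (w (n + K%:Z) - w (n + K%:Z + 1)))).
    have -> : n + K%:Z + 1 = n + K.+1%:Z by lia.
    by rewrite -natr1 scalerDl scale1r subrKA addrACA -opprD subrKA.
  apply: le_trans (snD _ _ _) _; rewrite -natr1 mulrDl mul1r lerD//.
  by apply: le_trans (snD _ _ _) _; rewrite hy addr0.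
have : q (w n - w (n + K%:Z)) <= D + D.
  by apply: le_trans (snB _ _ _) _; exact: lerD.
have := sn_le_add q (w n - w (n + K%:Z)) (K%:R *: y n).
rewrite snZ ger0_norm//.
move=> h1 h2 h3; apply: le_trans h1 _; rewrite addrC; exact: lerD.
Qed.

Lemma antidifference_left (x y w : int -> E) (C D : R) (n : int) :
  (forall m, q (x m - (y m - y (m + 1))) = 0) ->
  (forall m, q (y m - (w m - w (m + 1))) = 0) ->
  (forall m, q (w m) <= D) ->
  0 <= C -> (forall i : nat, q (x (n - 1 - i%:Z)) <= C * rho ^+ i) ->
  q (y n) <= C / (1 - rho).
Proof.
move=> hx hy hD C0 hC.
rewrite -[n]opprK.
(* Reflection of the index. It reverses every difference, whence the signs, and exchanges the two
   ends of each step, whence the offsets by one. *)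
apply: (@antidifference_right (fun k => - x (- k - 1)) (fun k => y (- k))
          (fun k => - w (- k + 1)) C D (- n)) => //.
- move=> m; rewrite (_ : - (m + 1) = - m - 1); last lia.
  rewrite (_ : y (- m) = y (- m - 1 + 1)); last by congr (y _); lia.
  by rewrite -opprD snN -(opprB (y _)) -(hx (- m - 1)); congr (q (_ + _)).
- move=> m; rewrite (_ : - (m + 1) + 1 = - m); last lia.
  by rewrite opprK (addrC (- w _)); exact: hy.
- by move=> m; rewrite snN.
- move=> i; rewrite snN; have -> : - (- n + i%:Z) - 1 = n - 1 - i%:Z by lia.
  exact: hC.
Qed.

Let kappa := rho / (1 - rho) ^+ 2.

(* Two antidifferences gain the factor [kappa]: the weight [rho ^ |n|] is
   recentred by one after two steps. *)
Lemma antidifference_twice (x y w z : int -> E) (C D : R) :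
  (forall m, q (x m - (y m - y (m + 1))) = 0) ->
  (forall m, q (y m - (w m - w (m + 1))) = 0) ->
  (forall m, q (w m - (z m - z (m + 1))) = 0) ->
  (forall m, q (w m) <= D) -> (forall m, q (z m) <= D) ->
  0 <= C -> (forall m, q (x m) <= C * rho ^+ `|m|%N) ->
  forall m, q (w (m + 1)) <= C * kappa * rho ^+ `|m|%N.
Proof.
move=> hx hy hw hD hD' C0 hC.
have r1 : 0 < 1 - rho by rewrite subr_gt0.
have yr (n : nat) : q (y n%:Z) <= C * rho ^+ n / (1 - rho).
  apply: (antidifference_right hx hy hD); first by rewrite mulr_ge0// exprn_ge0.
  move=> i; apply: le_trans (hC _) _; rewrite -mulrA -exprD.
  by have -> : absz (n%:Z + i%:Z)%R = (n + i)%N by lia.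
(* The leftward sum at [- n] starts with [x (- n - 1)] and so gains one power of [rho] over the
   rightward sum. Evaluating [w] at [m + 1] gives the rightward side the same gain. *)
have yl (n : nat) : q (y (- n%:Z)) <= C * rho ^+ n.+1 / (1 - rho).
  apply: (antidifference_left hx hy hD); first by rewrite mulr_ge0// exprn_ge0.
  move=> i; apply: le_trans (hC _) _; rewrite -mulrA -exprD.
  by have -> : absz (- n%:Z - 1 - i%:Z)%R = (n.+1 + i)%N by lia.
have yr0 (n : nat) : 0 <= C * rho ^+ n / (1 - rho).
  by rewrite divr_ge0 ?(ltW r1)// mulr_ge0// exprn_ge0.
move=> m.
have fin (n : nat) : C * kappa * rho ^+ n = C * rho ^+ n.+1 / (1 - rho) / (1 - rho).
  by rewrite /kappa (exprS rho); field; rewrite gt_eqF.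
have [m0|m0] := leP 0 m.
  rewrite fin; apply: (antidifference_right hy hw hD') => // i.
  have -> : m + 1 + i%:Z = (`|m|%N.+1 + i)%N :> int by lia.
  by apply: le_trans (yr _) _; rewrite exprD mulrA mulrAC.
rewrite fin; apply: (antidifference_left hy hw hD') => // i.
have -> : m + 1 - 1 - i%:Z = - (`|m|%N + i)%N%:Z by lia.
by apply: le_trans (yl _) _; rewrite -addSn exprD mulrA mulrAC.
Qed.

(** Going up two levels multiplies the decay constant by [kappa] and recentres by one ([decay]);
    coming back down costs [2] per level ([back]). So [psi 0] is at most [C * (4 * kappa) ^ m] for
    every [m]. The bound [D] may depend on the level because it never enters these constants. *)
Lemma flat_chain_null (psi : nat -> int -> E) (C : R) :
  4 * kappa < 1 ->
  (forall m n, q (psi m n - (psi m.+1 n - psi m.+1 (n + 1))) = 0) ->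
  (forall m, exists D, forall n, q (psi m n) <= D) ->
  (forall n, q (psi 0 n) <= C * rho ^+ `|n|%N) ->
  forall n, q (psi 0 n) = 0.
Proof.
move=> k1 hpsi hD hC.
have r1 : 0 < 1 - rho by rewrite subr_gt0.
have C0 : 0 <= C.
  have := hC 0; rewrite absz0 expr0 mulr1; apply: le_trans; exact: sn_ge0.
have kappa0 : 0 <= kappa by rewrite divr_ge0// exprn_ge0// ltW.
have decay m n : q (psi m.*2 (n + m%:Z)) <= C * kappa ^+ m * rho ^+ `|n|%N.
  elim: m n => [|m IH] n; first by rewrite addr0 expr0 mulr1.
  have [D1 h1] := hD m.*2.+2; have [D2 h2] := hD m.*2.+3.
  have -> : n + m.+1%:Z = n + 1 + m%:Z by lia.
  rewrite exprSr mulrA doubleS.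
  apply: (@antidifference_twice (fun k => psi m.*2 (k + m%:Z))
    (fun k => psi m.*2.+1 (k + m%:Z)) (fun k => psi m.*2.+2 (k + m%:Z))
    (fun k => psi m.*2.+3 (k + m%:Z)) (C * kappa ^+ m) (Num.max D1 D2)) => //.
  - by move=> k; rewrite -(hpsi m.*2 (k + m%:Z)); congr (q (_ - (_ - psi _ _))); lia.
  - by move=> k; rewrite -(hpsi m.*2.+1 (k + m%:Z)); congr (q (_ - (_ - psi _ _))); lia.
  - by move=> k; rewrite -(hpsi m.*2.+2 (k + m%:Z)); congr (q (_ - (_ - psi _ _))); lia.
  - by move=> k; rewrite le_max h1.
  - by move=> k; rewrite le_max h2 orbT.
  - by rewrite mulr_ge0// exprn_ge0.
have back m c : (forall n, q (psi m n) <= c) -> forall n, q (psi 0 n) <= 2 ^+ m * c.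
  elim: m c => [|m IH] c h n; first by rewrite expr0 mul1r.
  rewrite exprSr -mulrA; apply: IH => {}n.
  apply: le_trans (sn_le_of_null (hpsi m n)) _.
  apply: le_trans (snB _ _ _) _; rewrite mulr_natl mulr2n; exact: lerD.
move=> n; apply: sn_eq0; apply: (@geo_vanish _ _ C (4 * kappa)) => //.
  by rewrite mulr_ge0.
move=> m; have h2 : (2 : R) ^+ m.*2 = 4 ^+ m.
  by rewrite -mul2n exprM; congr (_ ^+ m); rewrite expr2; lra.
rewrite exprMn mulrCA -h2; apply: back => k; have -> : k = k - m%:Z + m%:Z by lia.
apply: le_trans (decay _ _) _; rewrite ler_piMr//.
  by rewrite mulr_ge0// exprn_ge0.
by rewrite exprn_ile1// ltW.
Qed.

End FlatChain.

(** * An operator divisible by every power of 1 - T *)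

Record isometric_action (R : realType) (E : lmodType R) (N : seminorm E) :=
  IsometricAction {
  act :> int -> E -> E;
  actD : forall n x y, act n (x + y) = act n x + act n y;
  actZ : forall n a x, act n (a *: x) = a *: act n x;
  act0 : forall x, act 0 x = x;
  actM : forall m n x, act (m + n) x = act m (act n x);
  act_iso : forall n x, N (act n x) = N x }.

Section TruncatedResolvent.
Context (R : realType) (E : lmodType R) (N : seminorm E).
Variable T : isometric_action N.
Implicit Types (x y : E) (t : R) (L : nat).

Lemma act_0 n : T n 0 = 0.
Proof. by rewrite -{1}(scale0r (0 : E)) actZ scale0r. Qed.

Lemma actN n x : T n (- x) = - T n x.
Proof. by rewrite -scaleN1r actZ scaleN1r. Qed.

Lemma actB n x y : T n (x - y) = T n x - T n y.
Proof. by rewrite actD actN. Qed.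

Lemma actC m n x : T m (T n x) = T n (T m x).
Proof. by rewrite -!actM addrC. Qed.

(* The truncation of the resolvent [(1 - tT)^-1]. *)
Definition tres t L x : E := \sum_(i < L) t ^+ i *: T i%:Z x.

Lemma tresS t L x : tres t L.+1 x = tres t L x + t ^+ L *: T L%:Z x.
Proof. by rewrite /tres big_ord_recr. Qed.

Lemma tresD t L x y : tres t L (x + y) = tres t L x + tres t L y.
Proof.
by rewrite /tres -big_split; apply: eq_bigr => i _; rewrite /= actD scalerDr.
Qed.

Lemma tresZ t L a x : tres t L (a *: x) = a *: tres t L x.
Proof.
rewrite /tres scaler_sumr; apply: eq_bigr => i _.
by rewrite actZ !scalerA mulrC.
Qed.

Lemma tresB t L x y : tres t L (x - y) = tres t L x - tres t L y.
Proof. by rewrite tresD -scaleN1r tresZ scaleN1r. Qed.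

Lemma tres_diffB t L x y :
  tres t L (x - T 1 x) - tres t L (y - T 1 y) =
  tres t L ((x - y) - T 1 (x - y)).
Proof.
rewrite -tresB actB; congr tres.
by rewrite !opprB (addrC (T 1 y) (- y)) addrACA (addrC (- T 1 x)).
Qed.

Lemma tres_comm (A : E -> E) t L x :
  (forall u v, A (u + v) = A u + A v) -> (forall a u, A (a *: u) = a *: A u) ->
  (forall n u, A (T n u) = T n (A u)) -> A (tres t L x) = tres t L (A x).
Proof.
move=> AD AZ AT; elim: L => [|L IH]; last by rewrite !tresS AD IH AZ AT.
by rewrite /tres !big_ord0 -(scale0r 0) AZ !scale0r.
Qed.

Lemma tres_act t L n x : T n (tres t L x) = tres t L (T n x).
Proof.
by apply: tres_comm => *; rewrite ?actD ?actZ// actC.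
Qed.

Lemma tres_le t L x : 0 <= t ->
  N (tres t L x) <= (\sum_(i < L) t ^+ i) * N x.
Proof.
move=> t0; rewrite mulr_suml.
apply: le_trans (sn_sum _ _ (fun i => t ^+ i *: T i%:Z x)) _.
apply: ler_sum => i _; rewrite snZ act_iso ger0_norm// exprn_ge0//.
Qed.

Lemma tres_null t L x : 0 <= t -> N x = 0 -> N (tres t L x) = 0.
Proof.
by move=> t0 x0; apply: sn_eq0; rewrite (le_trans (tres_le _ _ t0))// x0 mulr0.
Qed.

Lemma tres_resolvent t L y :
  tres t L y - t *: T 1 (tres t L y) = y - t ^+ L *: T L%:Z y.
Proof.
elim: L => [|L IH].
  by rewrite /tres !big_ord0 act_0 scaler0 subrr expr0 scale1r act0 subrr.
rewrite tresS actD scalerDr opprD addrACA IH actZ scalerA -exprS -actM.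
by rewrite subrKA (_ : 1 + L%:Z = L.+1%:Z)//; lia.
Qed.

(** Summation by parts. The coefficients [(1 - t) * t ^ i] for [i < L] and [t ^ L] add up to [1], so
    what is subtracted from [x] is, for [t] in [[0, 1]], a convex combination of isometric images of
    [x]; this is the source of the constant [2] in [tres_diff_le]. *)
Lemma tres_diff t L x : tres t L.+1 (x - T 1 x) =
  x - ((1 - t) *: T 1 (tres t L x) + t ^+ L *: T L.+1%:Z x).
Proof.
elim: L => [|L IH].
  rewrite /tres big_ord_recl !big_ord0 addr0 expr0 !scale1r act0.
  by rewrite act_0 scaler0 add0r.
rewrite tresS IH tresS actB actD actZ -!actM.
have -> : 1 + L%:Z = L.+1%:Z by lia.
have -> : L.+1%:Z + 1 = L.+2%:Z by lia.
rewrite scalerBr (scalerDr (1 - t)) scalerA mulrBl mul1r -exprS (scalerBl (t ^+ L)).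
move: (t ^+ L.+1 *: T L.+1 x) (t ^+ L *: T L.+1 x) (t ^+ L.+1 *: T L.+2 x) => a b c.
move: ((1 - t) *: T 1 (tres t L x)) => d.
have -> : d + (b - a) + c = (d + b) - (a - c).
  rewrite opprB [RHS]addrACA.
  by rewrite addrAC.
by move: (d + b) (a - c) => e f; rewrite opprB addrA addrAC.
Qed.

Lemma onem_geo t L : (1 - t) * (\sum_(i < L) t ^+ i) = 1 - t ^+ L.
Proof.
elim: L => [|L IH]; first by rewrite big_ord0 mulr0 expr0 subrr.
by rewrite big_ord_recr/= mulrDr IH mulrBl mul1r -exprS subrKA.
Qed.

Lemma tres_diff_le t L x : 0 <= t -> t < 1 ->
  N (tres t L (x - T 1 x)) <= 2 * N x.
Proof.
move=> t0 t1; case: L => [|L].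
  by rewrite /tres big_ord0 sn0 mulr_ge0// sn_ge0.
rewrite tres_diff mulr_natl mulr2n.
apply: le_trans (snB _ _ _) _; rewrite lerD2l.
apply: le_trans (snD _ _ _) _; rewrite !snZ !act_iso !ger0_norm ?exprn_ge0//.
  have e : N x - t ^+ L * N x = (1 - t ^+ L) * N x by rewrite mulrBl mul1r.
  rewrite -lerBrDr e -onem_geo -mulrA.
  by apply: ler_wpM2l; [rewrite subr_ge0 ltW|exact: tres_le].
by rewrite subr_ge0 ltW.
Qed.

(** On a difference, the subtracted average of [tres_diff] is again a [tres] of a difference,
    bounded uniformly in [L] by [tres_diff_le], so its factor [1 - t] makes it small. One takes [t]
    close to [1] first, then [L] large. *)
Lemma tres_diff_approx t L x : 0 <= t -> t < 1 ->
  N (tres t L.+1 ((x - T 1 x) - T 1 (x - T 1 x)) - (x - T 1 x)) <=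
  (2 * (1 - t) + 2 * t ^+ L) * N x.
Proof.
move=> t0 t1; rewrite tres_diff addrAC subrr add0r snN.
apply: le_trans (snD _ _ _) _; rewrite !snZ !act_iso !ger0_norm ?exprn_ge0//.
  rewrite [leRHS]mulrDl lerD//.
    rewrite mulrAC [X in _ <= X]mulrC; apply: ler_wpM2l.
      by rewrite subr_ge0 ltW.
    exact: tres_diff_le.
  rewrite mulrAC [X in _ <= X]mulrC; apply: ler_wpM2l; first exact: exprn_ge0.
  by apply: le_trans (snB _ _ _) _; rewrite act_iso mulr_natl mulr2n.
by rewrite subr_ge0 ltW.
Qed.

(* [tres t L.+1 (chi - T chi)] is [(1 - T)(1 - (tT)^L.+1)/(1 - tT)] applied to
   [chi]: the factors [1 - tT] and [1 - (tT)^L.+1] are invertible, and [1 - T]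
   is injective on the orbit of a difference. *)
Lemma tres_diff_inj (q : seminorm E) t L chi omega : 0 <= t -> t < 1 ->
  (forall x, q x <= N x) ->
  N (chi - (omega - T 1 omega)) = 0 ->
  (forall n, q (T n (tres t L.+1 (chi - T 1 chi))) = 0) ->
  forall n, q (T n chi) = 0.
Proof.
move=> t0 t1 qN hchi hq.
pose y := chi - T 1 chi.
have T0 x n : N x = 0 -> q (T n x) = 0.
  by move=> x0; apply: sn_eq0; rewrite (le_trans (qN _))// act_iso x0.
have step n : q (T n y) <= t ^+ L.+1 * q (T (n + L.+1%:Z) y).
  have : q (T n (tres t L.+1 y - t *: T 1 (tres t L.+1 y))) = 0.
    apply: sn_eq0; rewrite actB actZ -actM.
    by apply: le_trans (snB _ _ _) _; rewrite snZ !hq mulr0 addr0.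
  rewrite tres_resolvent actB actZ -actM => /sn_le_of_null.
  by rewrite snZ ger0_norm// exprn_ge0.
have y0 n : q (T n y) = 0.
  apply: sn_eq0; apply: (@geo_vanish _ _ (N y) (t ^+ L.+1)).
  - by rewrite exprn_ge0.
  - by rewrite exprn_ilt1.
  move=> m; elim: m n => [|m IH] n.
    by rewrite expr0 mulr1 (le_trans (qN _))// act_iso.
  apply: le_trans (step n) _.
  by rewrite (exprS (t ^+ L.+1)) mulrCA ler_wpM2l ?exprn_ge0.
move=> n; apply: sn_eq0.
(* Modulo [q] the orbit of [chi] is constant and is the difference of the bounded orbit of [omega]:
   [antidifference_right] applies with [x = 0], [C = 0] and [rho = 0]. *)
rewrite -(mul0r ((1 - 0 : R)^-1)).
apply: (@antidifference_right _ _ q 0 _ _ (fun=> 0) (fun n => T n chi)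
  (fun n => T n omega) 0 (N omega)) => //.
- by move=> m; rewrite sub0r snN actM -actB.
- by move=> m; rewrite actM -!actB T0.
- by move=> m; rewrite (le_trans (qN _))// act_iso.
- by move=> i; rewrite sn0 mul0r.
Qed.

End TruncatedResolvent.

Lemma exists_resolvent_parameters (R : realType) (d : R) : 0 < d ->
  exists tL : R * nat, [/\ 0 <= tL.1, tL.1 < 1 &
    2 * (1 - tL.1) + 2 * tL.1 ^+ tL.2 <= d].
Proof.
move=> d0; pose e := Num.min d 1.
have e0 : 0 < e by rewrite lt_min d0 ltr01.
have e1 : e <= 1 by rewrite ge_min lexx orbT.
have ed : e <= d by rewrite ge_min lexx.
(* Each of the two terms gets [e / 2]; the minimum with [1] keeps [t] nonnegative. *)
pose t := 1 - e / 4.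
have t0 : 0 <= t by rewrite /t; lra.
have t1 : t < 1 by rewrite /t; lra.
have : (fun L => t ^+ L) @ \oo --> (0 : R) by apply: cvg_expr; rewrite ger0_norm.
move=> /cvgrPdist_le /(_ (e / 4)); rewrite divr_gt0// => /(_ isT) [L _ hL].
exists (t, L); split => //=.
have := hL L (leqnn L); rewrite /= sub0r normrN ger0_norm ?exprn_ge0// => h.
by rewrite {1}/t; lra.
Qed.

(** * Convergence of the infinite product of truncated resolvents *)

Section FlatApproximateIdentity.
Context (R : realType) (E : lmodType R) (N : seminorm E).
Hypothesis complete : forall (u : nat -> E) (c : R),
  (forall k, N (u k.+1 - u k) <= c * 2^-1 ^+ k) ->
  exists x, forall k, N (x - u k) <= 2 * c * 2^-1 ^+ k.
Variable T : isometric_action N.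
Variables (tL : nat -> R * nat).
Hypothesis t0 : forall j, 0 <= (tL j).1.
Hypothesis t1 : forall j, (tL j).1 < 1.
Hypothesis tLd : forall j,
  2 * (1 - (tL j).1) + 2 * (tL j).1 ^+ (tL j).2 <= 4^-1 ^+ j.
Implicit Types x y : E.

Let S j x := tres T (tL j).1 (tL j).2.+1 x.

(* The factor [S j (1 - T)] has norm at most [2] and is close to the identity on
   the image of [1 - T]: the products converge, and each factor provides one
   more [1 - T]. *)
Fixpoint flat_prod k j x : E :=
  if k is k'.+1 then S j (flat_prod k' j.+1 x - T 1 (flat_prod k' j.+1 x))
  else x - T 1 x.

(** The two products differ only in the innermost factor, of level [j + k], by at most
    [4^-1 ^ (j + k)]; the [k] outer factors each at most double this error. Tolerances in [4^-1 ^ j]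
    thus still leave a convergent geometric series. *)
Lemma flat_prod_step k j x :
  N (flat_prod k.+1 j x - flat_prod k j x) <= 4^-1 ^+ j * N x * 2^-1 ^+ k.
Proof.
elim: k j => [|k IH] j.
  rewrite expr0 mulr1 /=; apply: le_trans (tres_diff_approx T (tL j).2 x (t0 j) (t1 j)) _.
  by rewrite ler_wpM2r// sn_ge0.
set u := flat_prod k.+1 j.+1 x; set v := flat_prod k j.+1 x.
have -> : flat_prod k.+2 j x - flat_prod k.+1 j x =
  S j ((u - v) - T 1 (u - v)).
  exact: tres_diffB.
apply: le_trans (tres_diff_le T (tL j).2.+1 _ (t0 j) (t1 j)) _.
apply: le_trans (ler_wpM2l _ (IH _)) _ => //.
rewrite !exprS; have := sn_ge0 N x.
have : 0 <= (4^-1 : R) ^+ j by rewrite exprn_ge0.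
have : 0 <= (2^-1 : R) ^+ k by rewrite exprn_ge0.
move: (_ ^+ _) (_ ^+ _) (N x) => a b c a0 b0 c0.
have : 0 <= b * c * a by rewrite !mulr_ge0.
nra.
Qed.

Lemma flat_prodD k j x y :
  flat_prod k j (x + y) = flat_prod k j x + flat_prod k j y.
Proof.
elim: k j => [|k IH] j /=; first by rewrite actD opprD addrACA.
by rewrite IH actD opprD addrACA; exact: tresD.
Qed.

Lemma flat_prodZ k j a x : flat_prod k j (a *: x) = a *: flat_prod k j x.
Proof.
elim: k j => [|k IH] j /=; first by rewrite actZ scalerBr.
by rewrite IH actZ -scalerBr; exact: tresZ.
Qed.

Lemma flat_prod_comm (A : E -> E) k j x :
  (forall u v, A (u + v) = A u + A v) -> (forall a u, A (a *: u) = a *: A u) ->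
  (forall n u, A (T n u) = T n (A u)) ->
  A (flat_prod k j x) = flat_prod k j (A x).
Proof.
move=> AD AZ AT; have AB u v : A (u - v) = A u - A v.
  by rewrite AD -scaleN1r AZ scaleN1r.
elim: k j => [|k IH] j /=; first by rewrite AB AT.
by rewrite /S tres_comm// AB AT IH.
Qed.

Lemma flat_limit_exists : exists chi : nat -> E -> E, forall j x k,
  N (chi j x - flat_prod k j x) <= 2 * (4^-1 ^+ j * N x) * 2^-1 ^+ k.
Proof.
have h (p : nat * E) : exists y, forall k,
    N (y - flat_prod k p.1 p.2) <= 2 * (4^-1 ^+ p.1 * N p.2) * 2^-1 ^+ k.
  by apply: complete => k; exact: flat_prod_step.
by have [f hf] := choice h; exists (fun j x => f (j, x)) => j x k; exact: (hf (j, x)).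
Qed.

(** The limit is chosen separately for each vector, so its linearity and its commutation with other
    operators hold only modulo [N]-null vectors. *)
Definition flat_limit : nat -> E -> E := sval (cid flat_limit_exists).

Lemma flat_limitP j x k :
  N (flat_limit j x - flat_prod k j x) <= 2 * (4^-1 ^+ j * N x) * 2^-1 ^+ k.
Proof. exact: (svalP (cid flat_limit_exists)). Qed.

Let half0 : 0 <= (2^-1 : R). Proof. by rewrite invr_ge0. Qed.
Let half1 : (2^-1 : R) < 1. Proof. by rewrite invf_lt1// ltr1n. Qed.

Lemma flat_limit_rec j x :
  N (flat_limit j x -
     S j (flat_limit j.+1 x - T 1 (flat_limit j.+1 x))) = 0.
Proof.
apply: sn_eq0.
apply: (@geo_vanish _ _ (2 * (4^-1 ^+ j * N x) + 2 * (2 * (4^-1 ^+ j.+1 * N x)))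
  2^-1) => // k.
apply: le_trans (sn_tri _ (flat_prod k.+1 j x) _ _) _; rewrite mulrDl lerD//.
  apply: le_trans (flat_limitP _ _ _) _; apply: ler_wpM2l.
    by rewrite !mulr_ge0// ?exprn_ge0// sn_ge0.
  by rewrite exprS ler_piMl ?exprn_ge0// ltW.
set u := flat_prod k j.+1 x; set v := flat_limit j.+1 x.
have -> : flat_prod k.+1 j x - S j (v - T 1 v) = S j ((u - v) - T 1 (u - v)).
  exact: tres_diffB.
apply: le_trans (tres_diff_le T (tL j).2.+1 _ (t0 j) (t1 j)) _.
by rewrite -mulrA ler_wpM2l// snBC; exact: flat_limitP.
Qed.

Lemma flat_limit_uniq j x y c :
  (forall k, N (y - flat_prod k j x) <= c * 2^-1 ^+ k) ->
  N (y - flat_limit j x) = 0.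
Proof.
move=> h; apply: sn_eq0.
apply: (@geo_vanish _ _ (c + 2 * (4^-1 ^+ j * N x)) 2^-1) => // k.
apply: le_trans (sn_tri _ (flat_prod k j x) _ _) _; rewrite mulrDl lerD//.
by rewrite snBC; exact: flat_limitP.
Qed.

Lemma flat_limit_lin j a x y :
  N (a *: flat_limit j x + flat_limit j y - flat_limit j (a *: x + y)) = 0.
Proof.
apply: (@flat_limit_uniq _ _ _
  (`|a| * (2 * (4^-1 ^+ j * N x)) + 2 * (4^-1 ^+ j * N y))) => k.
rewrite flat_prodD flat_prodZ opprD addrACA -scalerBr.
apply: le_trans (snD _ _ _) _; rewrite mulrDl snZ -mulrA lerD ?flat_limitP//.
by rewrite ler_wpM2l// flat_limitP.
Qed.

Lemma flat_limit_comm (A : E -> E) j x :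
  (forall u v, A (u + v) = A u + A v) -> (forall a u, A (a *: u) = a *: A u) ->
  (forall n u, A (T n u) = T n (A u)) -> (forall u, N (A u) = N u) ->
  N (A (flat_limit j x) - flat_limit j (A x)) = 0.
Proof.
move=> AD AZ AT AN; have AB u v : A (u - v) = A u - A v.
  by rewrite AD -scaleN1r AZ scaleN1r.
apply: (@flat_limit_uniq _ _ _ (2 * (4^-1 ^+ j * N x))) => k.
by rewrite -flat_prod_comm// -AB AN flat_limitP.
Qed.

Lemma flat_limit_approx j x :
  N (flat_limit j x - (x - T 1 x)) <= 2 * N x * 4^-1 ^+ j.
Proof.
by rewrite -mulrA (mulrC (N x)) -[leRHS]mulr1; exact: (@flat_limitP j x 0).
Qed.

Lemma flat_limit_le x : N (flat_limit 0 x) <= 4 * N x.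
Proof.
apply: le_trans (sn_le_add _ (x - T 1 x) _) _.
have -> : 4 * N x = (N x + N x) + 2 * N x * 4^-1 ^+ 0 by rewrite expr0; ring.
rewrite lerD ?flat_limit_approx//.
by apply: le_trans (snB _ _ _) _; rewrite act_iso.
Qed.

(** The product of the first [m] operators [S]. By [flat_limit_rec], [tres_iter m (flat_limit m x)]
    is an [m]-th antidifference of [flat_limit 0 x] up to null vectors; this is the chain given to
    [flat_chain_null]. *)
Fixpoint tres_iter m x : E :=
  if m is m'.+1 then tres_iter m' (S m' x) else x.

Let tres_iterB m x y : tres_iter m (x - y) = tres_iter m x - tres_iter m y.
Proof. by elim: m x y => [//|m IH] x y /=; rewrite -IH /S tresB. Qed.

Let tres_iter_act m n x : T n (tres_iter m x) = tres_iter m (T n x).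
Proof. by elim: m x => [//|m IH] x /=; rewrite IH /S tres_act. Qed.

Let tres_iter_null m x : N x = 0 -> N (tres_iter m x) = 0.
Proof. by elim: m x => [//|m IH] x x0 /=; apply/IH/tres_null. Qed.

Variable q : seminorm E.
Hypothesis qN : forall x, q x <= N x.

Let q_null n x : N x = 0 -> q (T n x) = 0.
Proof. by move=> x0; apply: sn_eq0; rewrite (le_trans (qN _))// act_iso x0. Qed.

Let pullback n x := q (T n (flat_limit 0 x)).

Let pullbackD n x y : pullback n (x + y) <= pullback n x + pullback n y.
Proof.
rewrite /pullback; have := flat_limit_lin 0 1 x y.
rewrite !scale1r snBC => /(q_null n); rewrite actB => /sn_le_of_null.
by move=> h; apply: (le_trans h); rewrite actD; exact: snD.
Qed.

Let pullbackZ n a x : pullback n (a *: x) = `|a| * pullback n x.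
Proof.
rewrite /pullback -snZ -actZ.
apply: sn_eq_of_null; rewrite -actB q_null// snBC.
(* Homogeneity is [flat_limit_lin] at [y = 0], where the chosen limit of [0] is known only to be
   [N]-null. *)
have W0 : N (flat_limit 0 0) = 0.
  by apply: sn_eq0; apply: le_trans (flat_limit_le 0) _; rewrite sn0 mulr0.
have := flat_limit_lin 0 a x 0; rewrite addr0 addrAC => h; apply: sn_eq0.
by have := snB N (a *: flat_limit 0 x - flat_limit 0 (a *: x) + flat_limit 0 0)
  (flat_limit 0 0); rewrite addrK h W0 addr0.
Qed.

(** Null vectors are invisible to [q], so this is a genuine seminorm although [flat_limit 0] is not
    exactly linear. Taylor expansions can therefore be estimated before the operator is applied. *)
Definition flat_pullback n : seminorm E := Seminorm (@pullbackD n) (@pullbackZ n).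

Lemma flat_pullback_le n x : flat_pullback n x <= 4 * N x.
Proof. by apply: le_trans (qN _) _; rewrite act_iso flat_limit_le. Qed.

Lemma flat_limit_null rho C x : 0 <= rho -> rho < 1 ->
  4 * (rho / (1 - rho) ^+ 2) < 1 ->
  (forall n, q (T n (flat_limit 0 x)) <= C * rho ^+ `|n|%N) ->
  forall n, q (T n (flat_limit 0 x)) = 0.
Proof.
move=> r0 r1 hr hC.
apply: (@flat_chain_null _ _ q rho r0 r1
  (fun m n => T n (tres_iter m (flat_limit m x))) C) => //.
  move=> m n; rewrite actM -!actB q_null// tres_iter_act -tres_iterB/=.
  by rewrite -tres_iterB tres_iter_null// flat_limit_rec.
move=> m; exists (N (tres_iter m (flat_limit m x))) => n.
by rewrite (le_trans (qN _))// act_iso.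
Qed.

(** Nullity climbs from [flat_limit j] to [flat_limit j.+1] by [tres_diff_inj], which applies
    because [flat_limit j.+1 x] is itself the difference of [S j.+1 (flat_limit j.+2 x)]. As [j]
    grows, [flat_limit j x] tends to [x - T 1 x]. *)
Lemma flat_limit_generates x :
  (forall n, q (T n (flat_limit 0 x)) = 0) ->
  forall n, q (T n (x - T 1 x)) = 0.
Proof.
move=> h0.
have h j n : q (T n (flat_limit j x)) = 0.
  elim: j n => [//|j IH].
  apply: (@tres_diff_inj _ _ _ T q _ (tL j).2 _
    (S j.+1 (flat_limit j.+2 x)) (t0 j) (t1 j)) => //.
    by rewrite /S tres_act -tresB flat_limit_rec.
  move=> n; apply: sn_eq0; rewrite -(IH n); apply: sn_le_of_null.
  by rewrite -actB q_null// snBC flat_limit_rec.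
move=> n; apply: sn_eq0; apply: (@geo_vanish _ _ (2 * N x) 4^-1).
- by rewrite invr_ge0.
- by rewrite invf_lt1// ltr1n.
move=> j; apply: le_trans (sn_le_add _ (T n (flat_limit j x)) _) _.
rewrite h add0r -actB (le_trans (qN _))// act_iso snBC.
exact: flat_limit_approx.
Qed.

End FlatApproximateIdentity.

(** * The space L1 of the line *)

(** The elements are functions, not classes modulo almost everywhere equality, so the L1 norm is
    only a seminorm here. *)
Notation L1space R := (LfunType (@lebesgue_measure R) (@lexx _ _ (1%E : \bar R))).

Section L1Space.
Context (R : realType).
Notation mu := (@lebesgue_measure R).
Implicit Types (f g : L1space R).

Lemma L1P f : L1 f.
Proof. exact/Lfun1_integrable/LfunP. Qed.

Definition toL1 (f : R -> R) (hf : L1 f) : L1space R :=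
  Lfun_Sub (lexx 1%E) ((Lfun1_integrable mu f).2 hf).

Lemma toL1E (f : R -> R) (hf : L1 f) t : toL1 hf t = f t.
Proof. by []. Qed.

Lemma L1addE f g t : (f + g) t = f t + g t.
Proof. by []. Qed.
Lemma L1scaleE a f t : (a *: f) t = a * f t.
Proof. by []. Qed.
Lemma L1oppE f t : (- f) t = - f t.
Proof. by []. Qed.

Lemma L1_ext f g : f =1 g -> f = g.
Proof. by move=> fg; exact/val_inj/funext. Qed.

Lemma measurable_EFin_norm (h : measurableTypeR R -> R) : measurable_fun setT h ->
  measurable_fun setT (fun t => `|h t|%:E : \bar R).
Proof. by move=> mh; apply/measurable_EFinP; exact: measurableT_comp. Qed.

Lemma L1_measurable f : measurable_fun setT (f : R -> R).
Proof. by have /integrableP[/measurable_EFinP] := L1P f. Qed.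

Lemma L1_measurable_norm f :
  measurable_fun [set: measurableTypeR R] (fun t => `|f t|%:E : \bar R).
Proof. by apply: measurable_EFin_norm; exact: L1_measurable. Qed.

Definition subr_const (a : R) : measurableTypeR R -> measurableTypeR R :=
  fun t => t - a.

Lemma measurable_subr_const a : measurable_fun setT (subr_const a).
Proof. exact: measurable_funB. Qed.

HB.instance Definition _ a :=
  isMeasurableFun.Build _ _ _ _ (subr_const a) (measurable_subr_const a).

Lemma lebesgue_measure_shift (a : R) (A : set R) : measurable A ->
  pushforward mu (subr_const a) A = mu A.
Proof.
move=> mA; apply/esym/lebesgue_measure_unique => //= _ [[x y]] _ <-.
rewrite /pushforward (_ : _ @^-1` _ = `]x + a, y + a]%classic).
  rewrite !lebesgue_measure_itv/= !lte_fin ltrD2r.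
  by case: ifP => // _; rewrite -!EFinB; congr EFin; ring.
by apply/seteqP; split => t /=; rewrite !in_itv/= ltrBrDr lerBlDr.
Qed.

Lemma L1_shift (a : R) (f : R -> R) : L1 f ->
  L1 (fun t => f (t - a)) /\
  (\int[mu]_t `|f (t - a)|%:E = \int[mu]_t `|f t|%:E)%E.
Proof.
move=> /integrableP[mf lf].
have e : (\int[mu]_t `|f (t - a)|%:E = \int[mu]_t `|f t|%:E)%E.
  transitivity (\int[pushforward mu (subr_const a)]_t `|f t|%:E)%E.
    rewrite (ge0_integral_pushforward (measurable_subr_const a) mu measurableT)//.
    by apply: measurable_EFin_norm; apply/measurable_EFinP; exact: mf.
  by apply: (eq_measure_integral mu) => A mA _; exact: lebesgue_measure_shift.
split=> //; apply/integrableP; split; last by rewrite e.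
exact: measurableT_comp mf (measurable_subr_const a).
Qed.

Definition L1norm f : R := fine (\int[mu]_t `|f t|%:E)%E.

Lemma L1norm_EFin f : (\int[mu]_t `|f t|%:E = (L1norm f)%:E)%E.
Proof.
rewrite fineK// ge0_fin_numE ?integral_ge0//.
by have /integrableP[] := L1P f.
Qed.

Lemma L1norm_le f g : (forall t, `|f t| <= `|g t|) -> L1norm f <= L1norm g.
Proof.
move=> h; rewrite -lee_fin -!L1norm_EFin; apply: ge0_le_integral => //.
- exact: L1_measurable_norm.
- exact: L1_measurable_norm.
- by move=> t _; rewrite lee_fin.
Qed.

Lemma L1normD f g : L1norm (f + g) <= L1norm f + L1norm g.
Proof.
rewrite -lee_fin EFinD -!L1norm_EFin -ge0_integralD//; last 2 first.
- exact: L1_measurable_norm.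
- exact: L1_measurable_norm.
apply: ge0_le_integral => //.
- exact: L1_measurable_norm.
- by apply: emeasurable_funD; exact: L1_measurable_norm.
- by move=> t _; rewrite -EFinD lee_fin L1addE ler_normD.
Qed.

Lemma L1normZ a f : L1norm (a *: f) = `|a| * L1norm f.
Proof.
apply: EFin_inj; rewrite EFinM -!L1norm_EFin -ge0_integralZl_EFin//.
- by apply: eq_integral => t _; rewrite L1scaleE normrM EFinM.
- exact: L1_measurable_norm.
Qed.

Definition L1sn : seminorm (L1space R) := Seminorm L1normD L1normZ.

Lemma L1norm0 : L1norm 0 = 0.
Proof. exact: (sn0 L1sn). Qed.

Lemma L1norm_ge0 f : 0 <= L1norm f.
Proof. exact: (sn_ge0 L1sn). Qed.

Lemma L1norm_tri g f h : L1norm (f - h) <= L1norm (f - g) + L1norm (g - h).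
Proof. exact: (sn_tri L1sn). Qed.

Definition L1shift (a : R) f : L1space R := toL1 (L1_shift a (L1P f)).1.

Lemma L1shift_norm a f : L1norm (L1shift a f) = L1norm f.
Proof. by congr fine; exact: (L1_shift a (L1P f)).2. Qed.

End L1Space.

Lemma L1_dominated (R : realType) (u : nat -> L1space R) (f : R -> R)
    (g : measurableTypeR R -> \bar R) :
  measurable_fun setT (f : measurableTypeR R -> R) ->
  {ae @lebesgue_measure R, forall t, (fun k => u k t) @ \oo --> f t} ->
  (@lebesgue_measure R).-integrable setT g ->
  (forall k t, (`|u k t|%:E <= g t)%E) ->
  exists hf : L1 f, (fun k => L1norm (toL1 hf - u k)) @ \oo --> 0.
Proof.
move=> mf cf ig ug.
have mu_ k : measurable_fun setT (fun t : measurableTypeR R => (u k t)%:E).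
  by apply/measurable_EFinP; exact: L1_measurable.
have mfE : measurable_fun setT (EFin \o f : measurableTypeR R -> \bar R).
  exact/measurable_EFinP.
have cE : {ae @lebesgue_measure R, forall t, setT t ->
    (fun k => (u k t)%:E) @ \oo --> (EFin \o f) t}.
  by apply: filterS cf => t ct _; apply: cvg_EFin; [exact: nearW|exact: ct].
have uE : {ae @lebesgue_measure R, forall t k, setT t -> (`|(u k t)%:E| <= g t)%E}.
  by apply: aeW => t k _; exact: ug.
have [hf h0 _] := dominated_convergence measurableT mu_ mfE cE ig uE.
exists hf.
move: h0; under eq_fun => k.
  rewrite (_ : (\int[_]_(t in _) _)%E = (L1norm (toL1 hf - u k))%:E); first over.
  rewrite -L1norm_EFin; apply: eq_integral => t _.
  by rewrite -EFinB abse_EFin distrC.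
by move=> /fine_cvgP[_].
Qed.

(** Riesz-Fischer with a rate. The sum [F] of the absolute increments is integrable, hence finite
    almost everywhere; there the sequence converges, and [|u 0| + F] dominates it. *)
Lemma L1_complete (R : realType) (u : nat -> L1space R) (c : R) :
  (forall k, L1norm (u k.+1 - u k) <= c * 2^-1 ^+ k) ->
  exists x, forall k, L1norm (x - u k) <= 2 * c * 2^-1 ^+ k.
Proof.
move=> uc; pose mu := @lebesgue_measure R.
have c0 : 0 <= c.
  by have := uc 0; rewrite expr0 mulr1; apply: le_trans; exact: L1norm_ge0.
pose d k t := `|u k.+1 t - u k t|.
have md k : measurable_fun setT (d k).
  by apply: measurableT_comp => //; apply: measurable_funB; exact: L1_measurable.
have geo n : \sum_(0 <= i < n) c * 2^-1 ^+ i <= 2 * c.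
  rewrite -mulr_sumr mulrC ler_wpM2r//.
  rewrite big_mkord; have h := @onem_geo R (2^-1) n.
  have : 0 <= (2^-1 : R) ^+ n by rewrite exprn_ge0.
  lra.
pose F t := (\sum_(0 <= k <oo) (d k t)%:E)%E.
have d0 k t : (0 <= (d k t)%:E)%E by rewrite lee_fin /d.
have F0 t : (0 <= F t)%E by apply: nneseries_ge0.
have iF : mu.-integrable setT F.
  apply/integrableP; split.
    by apply: ge0_emeasurable_sum => // k _; exact/measurable_EFinP.
  under eq_integral do rewrite gee0_abs//.
  rewrite integral_nneseries//; last by move=> k; exact/measurable_EFinP.
  apply: (@le_lt_trans _ _ (2 * c)%:E); last exact: ltry.
  apply: lime_le; first by apply: is_cvg_nneseries => n _ _; exact: integral_ge0.
  apply: nearW => n; apply: (@le_trans _ _ (\sum_(0 <= i < n) (c * 2^-1 ^+ i)%:E)%E).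
    by apply: lee_sum => k _; rewrite (L1norm_EFin (u k.+1 - u k)) lee_fin.
  by rewrite sumEFin lee_fin.
(* An upper limit is defined and measurable on the whole line, including the points where the
   sequence diverges. *)
pose f t := fine (limn_esup (fun k => (u k t)%:E)).
have mf : measurable_fun setT f.
  apply: measurableT_comp => //; apply: measurable_fun_limn_esup => n.
  by apply/measurable_EFinP; exact: L1_measurable.
have cvf : {ae mu, forall t, (fun k => u k t) @ \oo --> f t}.
  have := integrable_ae measurableT iF; apply: filterS => t /(_ I) Ft.
  have cu : cvgn (fun k => u k t).
    have cs : cvgn (series (telescope (fun k => u k t))).
      apply: normed_cvg.
      apply: nondecreasing_is_cvgn.
        by apply: nondecreasing_series => n _ _ /=; exact: normr_ge0.
      exists (fine (F t)) => _ [n _ <-].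
      rewrite -lee_fin fineK// /F /series /= -sumEFin.
      by apply: nneseries_lim_ge => k _ _; exact: d0.
    rewrite [X in cvgn X](_ : _ =
      series (telescope (fun k => u k t)) \+ cst (u 0%N t)).
      by apply: is_cvgD => //; exact: is_cvg_cst.
    by apply/funext => n; rewrite [LHS](eq_sum_telescope (fun k => u k t)) addrC.
  have ce : (fun k => (u k t)%:E) @ \oo --> (limn (fun k => u k t))%:E.
    by apply: cvg_EFin; [exact: nearW|exact: cu].
  rewrite /f is_cvg_limn_esupE; last by apply/cvg_ex; eexists; exact: ce.
  by rewrite (cvg_lim _ ce)//=; exact: cu.
have ig : mu.-integrable setT (fun t => `|u 0%N t|%:E + F t)%E.
  apply: integrableD => //.
  exact: (integrable_abse (L1P (u 0%N))).

have ug k t : (`|u k t|%:E <= `|u 0%N t|%:E + F t)%E.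
  rewrite (eq_sum_telescope (fun k => u k t)).
  apply: (@le_trans _ _ (`|u 0%N t| + \sum_(0 <= i < k) d i t)%:E).
    by rewrite lee_fin (le_trans (ler_normD _ _))// lerD2l ler_norm_sum.
  rewrite EFinD leeD2l// -sumEFin.
  by apply: nneseries_lim_ge => i _ _; exact: d0.
have [hf h0] := L1_dominated mf cvf ig ug.
exists (toL1 hf) => k.
have tail n : L1norm (u (k + n)%N - u k) <= 2 * c * 2^-1 ^+ k.
  apply: (@le_trans _ _ ((\sum_(0 <= i < n) c * 2^-1 ^+ i) * 2^-1 ^+ k)).
    elim: n => [|n IH].
      by rewrite addn0 subrr big_nil mul0r L1norm0.
    rewrite addnS big_nat_recr// [in leRHS]mulrDl.
    apply: (le_trans (L1norm_tri (u (k + n)%N) _ _)).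
    rewrite [leLHS]addrC; apply: (lerD IH).
    by rewrite -mulrA -exprD addnC; exact: uc.
  by rewrite ler_wpM2r ?exprn_ge0.
apply/ler_addgt0Pr => e e0.
have /cvgrPdist_lt/(_ _ e0)[n _ hn] := h0.
have /= := hn (k + n)%N (leq_addl _ _); rewrite sub0r normrN.
move=> /(le_lt_trans (ler_norm _)) /ltW hn'.
apply: (le_trans (L1norm_tri (u (k + n)%N) _ _)); rewrite [leLHS]addrC.
exact: lerD (tail n) hn'.
Qed.

(** * Gaussian moments *)

Section ExpTaylor.
Context (R : realType).
Implicit Types x y : R.

Definition expsum (n : nat) x : R := \sum_(i < n) x ^+ i / i`!%:R.

Lemma expsumS n x : expsum n.+1 x = expsum n x + x ^+ n / n`!%:R.
Proof. by rewrite /expsum big_ord_recr. Qed.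

Lemma expsum_cvg x : (expsum ^~ x) @ \oo --> expR x.
Proof.
rewrite (_ : (expsum ^~ x) = series (exp_coeff x)).
  exact: is_cvg_series_exp_coeff.
by apply/funext => n; rewrite /series /= big_mkord.
Qed.

Lemma expsum_le n y : 0 <= y -> expsum n y <= expR y.
Proof.
move=> y0; rewrite -(cvg_lim _ (expsum_cvg (x := y)))//.
apply: nondecreasing_cvgn_le; last by apply/cvg_ex; eexists; exact: expsum_cvg.
apply/nondecreasing_seqP => m; rewrite expsumS lerDl.
by rewrite divr_ge0// exprn_ge0.
Qed.

Lemma expsum_norm_le n x : `|expsum n x| <= expR `|x|.
Proof.
apply: le_trans (expsum_le n (normr_ge0 x)); rewrite /expsum.
apply: le_trans (ler_norm_sum _ _ _) _; apply: ler_sum => i _.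
by rewrite normrM normrX normfV normr_nat.
Qed.

Lemma fact_mono (m n : nat) : (m <= n)%N -> (m`! <= n`!)%N.
Proof.
move=> mn; rewrite dvdn_leq ?fact_gt0//; elim: n mn => [|n IH].
  by rewrite leqn0 => /eqP->.
by rewrite leq_eqVlt ltnS => /predU1P[->//|/IH h]; rewrite factS dvdn_mull.
Qed.

(** In the tail, [(n + k)!] is bounded below by [n!], which leaves [|x| ^ k] times the exponential
    series of [|x|]. *)
Lemma expR_taylor k x : `|expR x - expsum k x| <= `|x| ^+ k * expR `|x|.
Proof.
have h n : `|expsum (n + k) x - expsum k x| <= `|x| ^+ k * expsum n `|x|.
  elim: n => [|n IH].
    by rewrite subrr normr0 /expsum big_ord0 mulr0.
  rewrite addSn !expsumS addrAC mulrDr.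
  apply: le_trans (ler_normD _ _) _; apply: (lerD IH).
  rewrite normrM normrX normfV normr_nat exprD (mulrC (`|x| ^+ n)) -mulrA.
  rewrite ler_wpM2l ?exprn_ge0// ler_wpM2l ?exprn_ge0// lef_pV2 ?posrE ?ltr0n ?fact_gt0//.
  by rewrite ler_nat fact_mono// leq_addr.
have c : (fun n => `|expsum (n + k) x - expsum k x|) @ \oo --> `|expR x - expsum k x|.
  apply: cvg_norm; apply: cvgB; last exact: cvg_cst.
  by rewrite (cvg_shiftn k (expsum ^~ x)); exact: expsum_cvg.
rewrite -(cvg_lim _ c)//; apply: limr_le.
  by apply/cvg_ex; eexists; exact: c.
apply: nearW => n; apply: le_trans (h n) _.
by rewrite ler_wpM2l ?exprn_ge0// expsum_le.
Qed.

Lemma norm_expr_le_exp k x : `|x| ^+ k <= k`!%:R * expR `|x|.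
Proof.
have := expsum_le k.+1 (normr_ge0 x); rewrite expsumS => h.
rewrite mulrC -ler_pdivrMr ?ltr0n ?fact_gt0//; apply: le_trans h.
by rewrite lerDr sumr_ge0// => i _; rewrite divr_ge0// exprn_ge0.
Qed.

End ExpTaylor.

Section GaussianDomination.
Context (R : realType).

Lemma L1_le (f g : R -> R) : measurable_fun setT (f : measurableTypeR R -> R) ->
  L1 g -> (forall t, `|f t| <= `|g t|) -> L1 f.
Proof.
move=> mf ig fg; apply: (le_integrable measurableT _ _ ig).
  exact/measurable_EFinP.
by move=> t _; rewrite lee_fin.
Qed.

Lemma L1_scale a (f : R -> R) : L1 f -> L1 (fun t => a * f t).
Proof. by move=> lf; have := L1P (a *: toL1 lf). Qed.

Lemma L1_add (f g : R -> R) : L1 f -> L1 g -> L1 (fun t => f t + g t).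
Proof. by move=> lf lg; have := L1P (toL1 lf + toL1 lg). Qed.

Lemma L1_gaussian : L1 (fun t : R => expR (- (t ^+ 2 / 2))).
Proof.
have h := @integrable_normal_pdf R 0 1.
apply: (@L1_le _ (fun t => (normal_peak 1)^-1 * normal_pdf 0 1 t)).
- apply: measurableT_comp => //; apply: measurable_funN.
  by apply: measurable_funM => //; apply: measurable_funX.
- by apply: L1_scale; exact: h.
- move=> t; rewrite normal_pdfE ?oner_eq0// mulKf.
    by rewrite /normal_fun subr0 expr1n mulNr.
  by rewrite gt_eqF// normal_peak_gt0// oner_eq0.
Qed.

Lemma measurable_gauss_dominant (B : R) :
  measurable_fun setT ((fun t => expR (B * `|t| - t ^+ 2 / 2)) : measurableTypeR R -> R).
Proof.
apply: measurableT_comp => //; apply: measurable_funB.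
  by apply: measurable_funM => //; exact: measurableT_comp.
by apply: measurable_funM => //; apply: measurable_funX.
Qed.

(** Completing the square on each half-line bounds the function by a multiple of the sum of the
    Gaussians centred at [B] and [- B]. *)
Lemma L1_gauss_dominant (B : R) : L1 (fun t => expR (B * `|t| - t ^+ 2 / 2)).
Proof.
have s a := (L1_shift a L1_gaussian).1.
apply: (L1_le (measurable_gauss_dominant B)
  (L1_scale (expR (B ^+ 2 / 2)) (L1_add (s B) (s (- B))))).
move=> t; rewrite (ger0_norm (expR_ge0 _)) [leRHS]ger0_norm; last first.
  by rewrite mulr_ge0 ?expR_ge0// addr_ge0 ?expR_ge0.
rewrite mulrDr -!expRD.
have [t0|t0] := leP 0 t.
  apply: (@le_trans _ _ (expR (B ^+ 2 / 2 - (t - B) ^+ 2 / 2))).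
    by rewrite ler_expR ger0_norm// le_eqVlt; apply/orP; left; apply/eqP; field.
  by rewrite lerDl expR_ge0.
apply: (@le_trans _ _ (expR (B ^+ 2 / 2 - (t - - B) ^+ 2 / 2))).
  by rewrite ler_expR ltr0_norm// le_eqVlt; apply/orP; left; apply/eqP; field.
by rewrite lerDr expR_ge0.
Qed.

Definition gmom_fun (k : nat) (t : R) : R := t ^+ k * expR (- t ^+ 2).

Lemma measurable_gmom_fun k :
  measurable_fun setT (gmom_fun k : measurableTypeR R -> R).
Proof.
apply: measurable_funM; first exact: measurable_funX.
by apply: measurableT_comp => //; apply: measurable_funN; exact: measurable_funX.
Qed.

(** Half of the exponent [- t ^ 2] is kept for integrability; the rest absorbs the quadratic growth
    of [(t - a) ^ 2 / 4], and [|t| ^ k] is at most [k! * expR |t|]. The weight [1 / 4] decides which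
    Gaussians are multipliers in [multiplier_gauss]. *)
Lemma gmom_dominated k (A a t : R) : 0 <= A ->
  `|gmom_fun k t| * expR (A * `|t| + (t - a) ^+ 2 / 4) <=
  k`!%:R * expR (a ^+ 2 / 4) * expR ((A + 1 + `|a| / 2) * `|t| - t ^+ 2 / 2).
Proof.
move=> A0; rewrite normrM normrX (ger0_norm (expR_ge0 _)).
apply: le_trans (ler_wpM2r (expR_ge0 _)
  (ler_wpM2r (expR_ge0 _) (norm_expr_le_exp k t))) _.
rewrite -!mulrA ler_wpM2l// -!expRD ler_expR.
have : - (t * a) <= `|t| * `|a| by rewrite -normrM -normrN ler_norm.
have : 0 <= t ^+ 2 by exact: sqr_ge0.
move: (`|t|) (`|a|) => u v h1 h2; lra.
Qed.

Lemma L1_gmomM k (u : R -> R) (K A a : R) : 0 <= A ->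
  measurable_fun setT (u : measurableTypeR R -> R) ->
  (forall t, `|u t| <= K * expR (A * `|t| + (t - a) ^+ 2 / 4)) ->
  L1 (fun t => gmom_fun k t * u t).
Proof.
move=> A0 mu_ hu; pose c := k`!%:R * expR (a ^+ 2 / 4).
apply: (L1_le _ (L1_scale (K * c) (L1_gauss_dominant (A + 1 + `|a| / 2)))).
  by apply: measurable_funM => //; exact: measurable_gmom_fun.
have K0 : 0 <= K.
  have := le_trans (normr_ge0 _) (hu 0).
  by rewrite pmulr_lge0// expR_gt0.
move=> t; rewrite normrM; apply: le_trans (ler_wpM2l (normr_ge0 _) (hu t)) _.
rewrite mulrCA; apply: le_trans (ler_wpM2l K0 (gmom_dominated k a t A0)) _.
by rewrite mulrA; exact: ler_norm.
Qed.

Lemma L1_gmom k : L1 (gmom_fun k).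
Proof.
have h : L1 (fun t => gmom_fun k t * 1).
  apply: (@L1_gmomM k (fun=> 1) 1 0 0) => // t.
  by rewrite normr1 mul1r mul0r add0r -expR0 ler_expR divr_ge0// sqr_ge0.
by move: h; under eq_fun do rewrite mulr1.
Qed.

Definition gmom k : L1space R := toL1 (L1_gmom k).

Lemma L1sumE n (c : nat -> R) (f : nat -> L1space R) t :
  (\sum_(i < n) c i *: f i) t = \sum_(i < n) c i * f i t.
Proof.
elim: n => [|n IH]; first by rewrite !big_ord0.
by rewrite !big_ord_recr/= -IH.
Qed.

(** The factor [expR (b ^ 2)] turns the translate into [expR (- t ^ 2) * expR (2 * b * t)], whose
    expansion in [b] has the moments as coefficients. The remainder is dominated by [|b| ^ k.+1]
    times the function [H], which depends only on [A] and [k]; [D] is its norm. *)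
Lemma gauss_translate_taylor (A : R) k : 0 <= A -> exists2 D, 0 <= D &
  forall b, `|b| <= A -> L1norm (expR (b ^+ 2) *: L1shift b (gmom 0) -
    \sum_(j < k.+1) ((2 * b) ^+ j / j`!%:R) *: gmom j) <= D * `|b| ^+ k.+1.
Proof.
move=> A0; pose H t := 2 ^+ k.+1 * (gmom_fun k.+1 t * expR (2 * A * `|t|)).
have lH : L1 H.
  apply: L1_scale; apply: (@L1_gmomM _ _ 1 (2 * A) 0); first by rewrite mulr_ge0.
    apply: measurableT_comp => //; apply: measurable_funM => //.
  move=> t; rewrite ger0_norm ?expR_ge0// mul1r ler_expR lerDl divr_ge0//.
  exact: sqr_ge0.
exists (L1norm (toL1 lH)); first exact: L1norm_ge0.
move=> b bA.
have -> : L1norm (toL1 lH) * `|b| ^+ k.+1 = L1norm (`|b| ^+ k.+1 *: toL1 lH).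
  by rewrite L1normZ normrX normr_id mulrC.
apply: L1norm_le => t.
rewrite L1addE L1oppE (L1sumE _ (fun j => (2 * b) ^+ j / j`!%:R)) !L1scaleE.
have -> : L1shift b (gmom 0) t = expR (- (t - b) ^+ 2).
  by rewrite /L1shift /= /gmom_fun expr0 mul1r.
have -> : \sum_(j < k.+1) (2 * b) ^+ j / j`!%:R * gmom j t =
    expR (- t ^+ 2) * expsum k.+1 (2 * b * t).
  rewrite mulr_sumr; apply: eq_bigr => j _ /=.
  by rewrite /gmom_fun (exprMn _ _ t); ring.
have -> : expR (b ^+ 2) * expR (- (t - b) ^+ 2) =
    expR (- t ^+ 2) * expR (2 * b * t).
  by rewrite -!expRD; congr expR; ring.
rewrite -mulrBr normrM (ger0_norm (expR_ge0 _)).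
apply: le_trans (ler_wpM2l (expR_ge0 _) (expR_taylor k.+1 (2 * b * t))) _.
have -> : `|2 * b * t| = 2 * `|b| * `|t| by rewrite !normrM normr_nat.
have -> : `| `|b| ^+ k.+1 * toL1 lH t| = `|b| ^+ k.+1 *
    (2 ^+ k.+1 * (`|t| ^+ k.+1 * expR (- t ^+ 2) * expR (2 * A * `|t|))).
  rewrite toL1E /H /gmom_fun !normrM !normrX normr_id normr_nat.
  by rewrite !(ger0_norm (expR_ge0 _)).
rewrite !exprMn.
have : expR (2 * `|b| * `|t|) <= expR (2 * A * `|t|).
  by rewrite ler_expR ler_wpM2r// ler_wpM2l.
have : 0 <= 2 ^+ k.+1 * `|b| ^+ k.+1 * `|t| ^+ k.+1 * expR (- t ^+ 2).
  by rewrite !mulr_ge0 ?exprn_ge0 ?expR_ge0.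
move: (2 ^+ k.+1) (`|b| ^+ k.+1) (`|t| ^+ k.+1) (expR (- t ^+ 2)) => p x y e h0.
move: (expR _) (expR _) => u v uv.
have := ler_wpM2l h0 uv.
by congr (_ <= _); ring.
Qed.

End GaussianDomination.

(** * Distance to a span; signed translations *)

Section SpanDistance.
Context (R : realType) (E : lmodType R) (N : seminorm E) (I : Type) (v : I -> E).
Implicit Types (x y : E) (s : seq (R * I)).

Definition lincomb s : E := \sum_(p <- s) p.1 *: v p.2.

Lemma lincomb_cat s1 s2 : lincomb (s1 ++ s2) = lincomb s1 + lincomb s2.
Proof. by rewrite /lincomb big_cat. Qed.

Lemma lincomb_scale a s : lincomb [seq (a * p.1, p.2) | p <- s] = a *: lincomb s.
Proof.
by rewrite /lincomb big_map scaler_sumr; apply: eq_bigr => p _; rewrite scalerA.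
Qed.

Definition span_dist_fun x : R := inf [set N (x - lincomb s) | s in setT].

Lemma span_dist_le x s : span_dist_fun x <= N (x - lincomb s).
Proof.
by apply: ge_inf; [exists 0 => _ [s' _ <-]; exact: sn_ge0|exists s].
Qed.

Lemma span_dist_adherent x e : 0 < e ->
  exists s, N (x - lincomb s) < span_dist_fun x + e.
Proof.
move=> e0; have [|_ [s _ <-] h] := @inf_adherent R
  [set N (x - lincomb s) | s in setT] e e0; last by exists s.
split; first by exists (N (x - lincomb [::])), [::].
by exists 0 => _ [s _ <-]; exact: sn_ge0.
Qed.

Lemma span_distD x y :
  span_dist_fun (x + y) <= span_dist_fun x + span_dist_fun y.
Proof.
apply/ler_addgt0Pr => e e0.
have e20 : 0 < e / 2 by rewrite divr_gt0.
have [s hs] := span_dist_adherent x e20; have [t ht] := span_dist_adherent y e20.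
apply: le_trans (span_dist_le _ (s ++ t)) _.
rewrite lincomb_cat opprD addrACA; apply: le_trans (snD _ _ _) _.
apply: le_trans (lerD (ltW hs) (ltW ht)) _.
by rewrite addrACA -splitr.
Qed.

Lemma span_distZ a x : span_dist_fun (a *: x) = `|a| * span_dist_fun x.
Proof.
have le b y : span_dist_fun (b *: y) <= `|b| * span_dist_fun y.
  apply/ler_addgt0Pr => e e0.
  (* Dividing the tolerance by [|b| + 1] also covers [b = 0]. *)
  have b0 : 0 < `|b| + 1 by rewrite ltr_wpDl.
  have [s hs] := span_dist_adherent y (divr_gt0 e0 b0).
  apply: le_trans (span_dist_le _ [seq (b * p.1, p.2) | p <- s]) _.
  rewrite lincomb_scale -scalerBr snZ.
  apply: le_trans (ler_wpM2l (normr_ge0 b) (ltW hs)) _.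
  rewrite mulrDr lerD2l mulrA ler_pdivrMr// mulrC ler_wpM2l ?(ltW e0)//.
  by rewrite lerDl.
apply/eqP; rewrite eq_le le/=; have [->|a0] := eqVneq a 0.
  rewrite normr0 mul0r; apply: lb_le_inf.
    by exists (N (0 *: x - lincomb [::])), [::].
  by move=> _ [s _ <-]; exact: sn_ge0.
rewrite mulrC -ler_pdivlMr ?normr_gt0// mulrC -normfV.
by rewrite -{1}(scale1r x) -(mulVf a0) -scalerA; exact: le.
Qed.

Definition span_dist : seminorm E := Seminorm span_distD span_distZ.

Lemma span_dist_le_sn x : span_dist x <= N x.
Proof.
by have := span_dist_le x [::]; rewrite /lincomb big_nil subr0.
Qed.

Lemma span_dist_gen i : span_dist (v i) = 0.
Proof.
apply: sn_eq0; have := span_dist_le (v i) [:: (1, i)].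
by rewrite /lincomb big_seq1 scale1r subrr sn0.
Qed.

End SpanDistance.

Section ShiftAction.
Context (R : realType) (s c : R) (hs : `|s| = 1).
Implicit Types f g : L1space R.

Lemma L1shiftD a f g : L1shift a (f + g) = L1shift a f + L1shift a g.
Proof. exact: L1_ext. Qed.

Lemma L1shiftZ a b f : L1shift a (b *: f) = b *: L1shift a f.
Proof. exact: L1_ext. Qed.

Lemma L1shift0 f : L1shift 0 f = f.
Proof. by apply: L1_ext => t /=; rewrite subr0. Qed.

Lemma L1shift_add a b f : L1shift (a + b) f = L1shift a (L1shift b f).
Proof. by apply: L1_ext => t /=; congr (f _); ring. Qed.

(* With [s = - 1], the operator [1 - T] is one plus the translation, as the
   second generator requires. *)
Definition shift_act (n : int) f : L1space R := s ^ n *: L1shift (n%:~R * c) f.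

Let s0 : s != 0. Proof. by rewrite -normr_eq0 hs oner_eq0. Qed.

Lemma shift_actD n f g : shift_act n (f + g) = shift_act n f + shift_act n g.
Proof. by rewrite /shift_act L1shiftD scalerDr. Qed.

Lemma shift_actZ n a f : shift_act n (a *: f) = a *: shift_act n f.
Proof. by rewrite /shift_act L1shiftZ !scalerA mulrC. Qed.

Lemma shift_act0 f : shift_act 0 f = f.
Proof. by rewrite /shift_act expr0z scale1r mul0r L1shift0. Qed.

Lemma shift_actM m n f : shift_act (m + n) f = shift_act m (shift_act n f).
Proof.
rewrite /shift_act L1shiftZ scalerA -L1shift_add expfzDr// intrD mulrDl.
by [].
Qed.

Lemma norm_sign_exprz (n : int) : `|s ^ n| = 1.
Proof.
case: n => n; first by rewrite -exprnP normrX hs expr1n.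
by rewrite NegzE -exprnN normfV normrX hs expr1n invr1.
Qed.

Lemma shift_act_iso n f : L1sn R (shift_act n f) = L1sn R f.
Proof. by rewrite snZ norm_sign_exprz mul1r /= L1shift_norm. Qed.

Definition shift_action : isometric_action (L1sn R) :=
  IsometricAction shift_actD shift_actZ shift_act0 shift_actM shift_act_iso.

End ShiftAction.

(** * The induction on the moments *)

Section GaussianMoments.
Context (R : realType) (s c : R) (hs : `|s| = 1).
Let T := shift_action c hs.
Variables (tL : nat -> R * nat).
Hypothesis t0 : forall j, 0 <= (tL j).1.
Hypothesis t1 : forall j, (tL j).1 < 1.
Hypothesis tLd : forall j,
  2 * (1 - (tL j).1) + 2 * (tL j).1 ^+ (tL j).2 <= 4^-1 ^+ j.
Let W := @flat_limit R (L1space R) (L1sn R) (@L1_complete R) T tL t0 t1 tLd.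
Variable q : seminorm (L1space R).
Hypothesis qN : forall x, q x <= L1sn R x.
Variables (b : int -> R) (C rho : R).
Hypothesis rho0 : 0 <= rho.
Hypothesis rho1 : rho < 1.
Hypothesis hrho : 4 * (rho / (1 - rho) ^+ 2) < 1.
Hypothesis b0 : forall n, b n != 0.
Hypothesis bC : forall n, `|b n| <= C * rho ^+ `|n|%N.
Hypothesis hq : forall n : int,
  q (L1shift (n%:~R * c + b n) (W 0 (gmom R 0))) = 0.

Let nu n := @flat_pullback R (L1space R) (L1sn R) (@L1_complete R) T tL t0 t1 tLd
  q qN n.

(** Strong induction on [k]. Under [nu n] the shifted Gaussian vanishes, and so do the moments below
    [k]; the Taylor formula then bounds the single remaining term [(2 b) ^ k / k! g_k] by
    [O(|b| ^ k.+1)]. Dividing by [|b| ^ k], which is not zero, gives [O(|b|)], hence the decay that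
    [flat_limit_null] requires. *)
Lemma flat_gmom_null k n : q (T n (W 0 (gmom R k))) = 0.
Proof.
elim/ltn_ind: k n => k IH.
have C0 : 0 <= C.
  by have := bC 0; rewrite absz0 expr0 mulr1; apply: le_trans.
have bC' n : `|b n| <= C.
  by apply: le_trans (bC n) _; rewrite ler_piMr// exprn_ile1// ltW.
(* The perturbation [b n] is not a multiple of [c], but real shifts commute with [T] and hence with
   [W] up to null vectors, which brings the vector back to a translate of the generator. *)
have shift0 n : nu n (L1shift (b n) (gmom R 0)) = 0.
  have e : L1sn R (L1shift (b n) (W 0 (gmom R 0)) -
      W 0 (L1shift (b n) (gmom R 0))) = 0.
    apply: flat_limit_comm; [exact: L1shiftD|exact: L1shiftZ| |exact: L1shift_norm].
    move=> m u; rewrite /T /= /shift_act L1shiftZ -!L1shift_add.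
    by congr (_ *: L1shift _ _); rewrite addrC.
  change (q (T n (W 0 (L1shift (b n) (gmom R 0)))) = 0).
  rewrite -(@sn_eq_of_null _ _ q _ (T n (L1shift (b n) (W 0 (gmom R 0))))).
    by rewrite /T /= /shift_act snZ -L1shift_add hq mulr0.
  rewrite -actB; apply: sn_eq0; apply: le_trans (qN _) _.
  by rewrite act_iso e.
have [D D0 hD] := gauss_translate_taylor k C0.
apply: (@flat_limit_null _ _ _ _ _ _ _ _ _ _ qN rho (4 * D * k`!%:R * C) _
  rho0 rho1 hrho) => n.
change (nu n (gmom R k) <= 4 * D * k`!%:R * C * rho ^+ `|n|%N).
set B := b n; pose coef j : R := (2 * B) ^+ j / j`!%:R.
pose P m := \sum_(j < m) coef j *: gmom R j.
have B0 : 0 < `|B| by rewrite normr_gt0 b0.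
have lowP m : (m <= k)%N -> nu n (P m) = 0.
  move=> mk; apply: sn_eq0; apply: le_trans (sn_sum (nu n) m (fun j => coef j *: gmom R j)) _.
  rewrite big1// => j _; rewrite snZ.
  have -> : nu n (gmom R j) = 0 by apply: IH; exact: leq_trans (ltn_ord j) mk.
  by rewrite mulr0.
have nuP : nu n (P k.+1) <= 4 * D * `|B| ^+ k.+1.
  set x := expR (B ^+ 2) *: L1shift B (gmom R 0).
  apply: le_trans (sn_le_add _ x _) _; rewrite snZ shift0 mulr0 add0r snBC.
  apply: le_trans (flat_pullback_le _ _ _ _ _ _ _ _) _.
  by rewrite -[leRHS]mulrA ler_wpM2l//; exact: (hD B (bC' n)).
have nuk : nu n (coef k *: gmom R k) <= 4 * D * `|B| ^+ k.+1.
  have -> : coef k *: gmom R k = P k.+1 - P k.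
    by rewrite /P big_ord_recr/= addrAC subrr add0r.
  by apply: le_trans (snB _ _ _) _; rewrite (lowP k (leqnn k)) addr0.
have ck : `|coef k| = 2 ^+ k * `|B| ^+ k / k`!%:R.
  by rewrite /coef normrM normfV normr_nat normrX normrM normr_nat exprMn.
move: nuk; rewrite snZ ck => nuk.
have k1 : 1 <= (2 : R) ^+ k by rewrite exprn_ege1// ler1n.
have kf : 0 < (k`!%:R : R) by rewrite ltr0n fact_gt0.
have n0 : 0 <= nu n (gmom R k) by exact: sn_ge0.
have : nu n (gmom R k) <= 4 * D * k`!%:R * `|B|.
  have Bk : 0 < `|B| ^+ k by rewrite exprn_gt0.
  (* Restore the coefficient [|b| ^ k / k!]; the factor [2 ^ k >= 1] only helps. *)
  rewrite -(ler_pM2l Bk) -(ler_pM2l (_ : 0 < k`!%:R^-1)) ?invr_gt0//.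
  apply: (@le_trans _ _ (2 ^+ k * `|B| ^+ k / k`!%:R * nu n (gmom R k))).
    rewrite [leRHS](_ : _ = 2 ^+ k * (k`!%:R^-1 * (`|B| ^+ k * nu n (gmom R k)))).
      by rewrite ler_peMl// !mulr_ge0 ?invr_ge0 ?exprn_ge0.
    by rewrite -!mulrA; congr (_ * _); rewrite mulrCA.
  apply: le_trans nuk _; rewrite exprS le_eqVlt; apply/orP; left; apply/eqP.
  by field; rewrite gt_eqF.
move=> h; apply: le_trans h _; rewrite -[leRHS]mulrA ler_wpM2l//.
  by rewrite !mulr_ge0.
exact: bC.
Qed.

End GaussianMoments.

(** * Density of the Gaussian moments *)

Section NthPowerThreshold.
Context (R : realType).
Implicit Types y : R.

Lemma natmul_geo_cvg0 y : 0 <= y -> y < 1 -> (fun n => n%:R * y ^+ n) @ \oo --> 0.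
Proof.
rewrite le_eqVlt => /predU1P[<- _|y0 y1].
  apply: cvg_near_cst; exists 1%N => // -[//|n] _.
  by rewrite exprS mul0r mulr0.
pose h := - ln y; have h0 : 0 < h by rewrite oppr_gt0 ln_lt0// y0.
have yE n : y ^+ n = (expR (n%:R * h))^-1.
  by rewrite expRM_natl /h expRN lnK ?posrE// exprVn invrK.
(* From [x ^ 2 <= 2 * expR x] at [x = n * h]. At [n = 0] both sides are [0], since the inverse of
   [0] is [0]. *)
have b n : n%:R * y ^+ n <= 2 / h ^+ 2 * n%:R^-1.
  case: n => [|n]; first by rewrite mul0r invr0 mulr0.
  rewrite yE ler_pdivrMr ?expR_gt0//.
  have nh : 0 <= n.+1%:R * h by rewrite mulr_ge0// ltW.
  have := norm_expr_le_exp 2 (n.+1%:R * h); rewrite (ger0_norm nh) => e.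
  have n0 : 0 < n.+1%:R :> R by [].
  have -> : 2 / h ^+ 2 / n.+1%:R * expR (n.+1%:R * h) =
     (2 * expR (n.+1%:R * h)) / (h ^+ 2 * n.+1%:R).
    by field; rewrite !gt_eqF.
  rewrite ler_pdivlMr ?mulr_gt0 ?exprn_gt0//.
  by apply: le_trans e; rewrite le_eqVlt; apply/orP; left; apply/eqP; ring.
apply: (@squeeze_cvgr _ _ _ _ (cst 0) (fun n => 2 / h ^+ 2 * n%:R^-1)).
- apply: nearW => n; rewrite b andbT mulr_ge0// exprn_ge0// ltW//.
- exact: cvg_cst.
- rewrite -[X in _ --> X](mulr0 (2 / h ^+ 2)); apply: cvgMr.
  by rewrite -(cvg_shiftS _); exact: cvg_harmonic.
Qed.

(* The factor [n] of the exponent gives the limit at [y = 1 / 2]. *)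
Lemma power_threshold y : 0 <= y -> y <= 1 ->
  (fun n => (1 - y ^+ n) ^+ (n * 2 ^ n)) @ \oo --> ((y < 1 / 2)%R%:R : R).
Proof.
move=> y0 y1.
have z0 n : 0 <= 1 - y ^+ n by rewrite subr_ge0 exprn_ile1.
have z1 n : 1 - y ^+ n <= 1 by rewrite lerBlDr lerDl exprn_ge0.
have [yh|yh] := ltP y (1 / 2).
  have c : (fun n => 1 - n%:R * (2 * y) ^+ n) @ \oo --> (1 : R).
    rewrite -[X in _ --> X](subr0 1); apply: cvgB; first exact: cvg_cst.
    by apply: natmul_geo_cvg0; lra.
  apply: (@squeeze_cvgr _ _ _ _ (fun n => 1 - n%:R * (2 * y) ^+ n) (cst 1)) => //.
    apply: nearW => n; rewrite [leRHS]/= exprn_ile1// andbT.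
    (* Bernoulli's inequality; with [m = n * 2 ^ n] the loss is [n * (2 * y) ^ n], which tends to
       [0] because [2 * y < 1]. *)
    have bern (m : nat) : 1 - m%:R * y ^+ n <= (1 - y ^+ n) ^+ m.
      elim: m => [|m IH]; first by rewrite mul0r subr0 expr0.
      have := exprn_ile1 m (z0 n) (z1 n).
      have : 0 <= y ^+ n by rewrite exprn_ge0.
      rewrite exprS -natr1; move: IH; move: (m%:R) (y ^+ n) ((1 - _) ^+ m).
      move=> a b d; nra.
    apply: le_trans (bern _); rewrite exprMn natrM natrX.
    by rewrite -mulrA.
  exact: cvg_cst.
apply: (@squeeze_cvgr _ _ _ _ (cst 0) (fun n => n.+1%:R^-1)) => //.
- apply: nearW => n; rewrite exprn_ge0//=.
  (* From [1 - z <= expR (- z)], the power is at most [expR (- n * (2 * y) ^ n)], and here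
     [2 * y >= 1]. *)
  have : (1 - y ^+ n) ^+ (n * 2 ^ n) <= expR (- n%:R).
    apply: (@le_trans _ _ (expR (- y ^+ n) ^+ (n * 2 ^ n))).
      by apply: lerXn2r; rewrite ?nnegrE ?expR_ge0// expR_ge1Dx.
    rewrite -expRM_natl ler_expR mulrN lerN2 natrM natrX -mulrA -exprMn.
    by rewrite ler_peMr// exprn_ege1//; lra.
  move=> h; apply: le_trans h _; rewrite expRN lef_pV2 ?posrE ?expR_gt0//.
  by rewrite -natr1 addrC expR_ge1Dx.
- exact: cvg_cst.
- exact: cvg_harmonic.
Qed.

End NthPowerThreshold.

(** * The algebra of multipliers of the null functions *)

Section Multipliers.
Context (R : realType) (q : seminorm (L1space R)).
Hypothesis qN : forall x, q x <= L1norm x.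
Implicit Types f g u v w : R -> R.

Definition null f := exists h : L1 f, q (toL1 h) = 0.

Lemma null_ext f g : f =1 g -> null f -> null g.
Proof. by move=> /funext ->. Qed.

Lemma nullD f g : null f -> null g -> null (fun t => f t + g t).
Proof.
move=> [hf qf] [hg qg]; exists (L1_add hf hg); apply: sn_eq0.
rewrite (_ : toL1 _ = toL1 hf + toL1 hg); last exact: L1_ext.
by apply: le_trans (snD _ _ _) _; rewrite qf qg addr0.
Qed.

Lemma nullZ a f : null f -> null (fun t => a * f t).
Proof.
move=> [hf qf]; exists (L1_scale a hf).
by rewrite (_ : toL1 _ = a *: toL1 hf) ?snZ ?qf ?mulr0//; exact: L1_ext.
Qed.

(** Dominated convergence gives L1 convergence, and [q] is continuous for the L1 norm. *)
Lemma null_lim (u : nat -> R -> R) f g : (forall n, null (u n)) -> L1 g ->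
  (forall n t, `|u n t| <= g t) -> (forall t, (fun n => u n t) @ \oo --> f t) ->
  null f.
Proof.
move=> nu lg ug uf.
have /choice[U hU] n : exists V : L1space R, (V : R -> R) = u n /\ q V = 0.
  by have [h hq] := nu n; exists (toL1 h).
have UE n t : U n t = u n t by rewrite (hU n).1.
have mf : measurable_fun setT (f : measurableTypeR R -> R).
  apply: (measurable_fun_cvg (fun n => L1_measurable (U n))) => t _.
  by under eq_fun do rewrite UE; exact: uf.
have [hf h0] : exists hf : L1 f, (fun n => L1norm (toL1 hf - U n)) @ \oo --> 0.
  apply: (L1_dominated mf _ lg).
  - by apply: aeW => t; under eq_fun do rewrite UE; exact: uf.
  - by move=> n t; rewrite lee_fin UE; exact: ug.
exists hf; apply: sn_eq0; apply/ler_addgt0Pr => e e0; rewrite add0r.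
have /cvgrPdist_lt/(_ _ e0)[n _ /(_ n (leqnn n))] := h0.
rewrite /= sub0r normrN => /(le_lt_trans (ler_norm _))/ltW; apply: le_trans.
by apply: le_trans (sn_le_add q (U n) _) _; rewrite (hU n).2 add0r; exact: qN.
Qed.

(** Asking for all [k] at once makes this class stable under multiplication by [t], hence by
    polynomials. *)
Definition annihilated u := forall k, null (fun t => gmom_fun k t * u t).

Lemma annihilatedD u w : annihilated u -> annihilated w ->
  annihilated (fun t => u t + w t).
Proof.
by move=> hu hw k; apply: null_ext (nullD (hu k) (hw k)) => t; rewrite mulrDr.
Qed.

Lemma annihilatedZ a u : annihilated u -> annihilated (fun t => a * u t).
Proof.
by move=> hu k; apply: null_ext (nullZ a (hu k)) => t; rewrite mulrCA.
Qed.

Lemma annihilatedX u : annihilated u -> annihilated (fun t => t * u t).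
Proof.
move=> hu k; apply: null_ext (hu k.+1) => t.
by rewrite /gmom_fun exprSr -!mulrA; congr (_ * _); rewrite mulrCA.
Qed.

Lemma annihilated_quadratic x a m u : annihilated u ->
  annihilated (fun t => (- (x * (t - a) ^+ 2)) ^+ m * u t).
Proof.
have step w : annihilated w -> annihilated (fun t => (t - a) * w t).
  move=> hw k.
  have := annihilatedD (annihilatedX hw) (annihilatedZ (- a) hw) k.
  by apply: null_ext => t; rewrite -mulrDl.
move=> hu; elim: m => [|m IH] k.
  by apply: null_ext (hu k) => t; rewrite expr0 mul1r.
have := annihilatedZ (- x) (step _ (step _ IH)) k.
by apply: null_ext => t; rewrite [in RHS](exprS _ m); ring.
Qed.

Definition norm_bounded v := exists K : R, forall t, `|v t| <= K.

(** These functions form an algebra closed under bounded pointwise limits; the aim is to reach all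
    indicators of Borel sets. Acting on bounded functions only is what keeps the products
    dominated. *)
Definition multiplier v :=
  norm_bounded v /\
  forall u, norm_bounded u -> annihilated u -> annihilated (fun t => v t * u t).

Lemma multiplier_ext v w : v =1 w -> multiplier v -> multiplier w.
Proof. by move=> /funext ->. Qed.

Lemma norm_bounded_cst (c : R) : norm_bounded (fun=> c).
Proof. by exists `|c|. Qed.

Lemma norm_boundedM v w : norm_bounded v -> norm_bounded w ->
  norm_bounded (fun t => v t * w t).
Proof.
move=> [K hK] [L hL]; exists (K * L) => t; rewrite normrM.
by apply: ler_pM.
Qed.

Lemma multiplier_cst (c : R) : multiplier (fun=> c).
Proof. by split=> [|u _]; [exact: norm_bounded_cst|exact: annihilatedZ]. Qed.

Lemma multiplierD v w : multiplier v -> multiplier w ->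
  multiplier (fun t => v t + w t).
Proof.
move=> [[K hK] hv] [[L hL] hw]; split=> [|u bu hu k].
  by exists (K + L) => t; apply: le_trans (ler_normD _ _) _; exact: lerD.
apply: null_ext (annihilatedD (hv u bu hu) (hw u bu hu) k) => t.
by rewrite mulrDl.
Qed.

Lemma multiplierM v w : multiplier v -> multiplier w ->
  multiplier (fun t => v t * w t).
Proof.
move=> [bv hv] [bw hw]; split=> [|u bu hu k]; first exact: norm_boundedM.
apply: null_ext (hv _ (norm_boundedM bw bu) (hw u bu hu) k) => t.
by congr (_ * _); rewrite mulrA.
Qed.

Lemma multiplierC v : multiplier v -> multiplier (fun t => 1 - v t).
Proof.
move=> hv; apply: multiplier_ext (multiplierD (multiplier_cst 1)
  (multiplierM (multiplier_cst (-1)) hv)) => t.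
by rewrite mulN1r.
Qed.

Lemma multiplierXn v n : multiplier v -> multiplier (fun t => v t ^+ n).
Proof.
move=> hv; elim: n => [|n IH]; first exact: multiplier_cst.
by apply: multiplier_ext (multiplierM hv IH) => t; rewrite exprS.
Qed.

Lemma multiplier_lim (v : nat -> R -> R) w K : (forall n, multiplier (v n)) ->
  (forall n t, `|v n t| <= K) -> (forall t, (fun n => v n t) @ \oo --> w t) ->
  multiplier w.
Proof.
move=> hv vK vw; split.
  exists K => t; rewrite -(cvg_lim _ (cvg_norm (vw t)))//; apply: limr_le.
    by apply/cvg_ex; eexists; exact: cvg_norm (vw t).
  by apply: nearW => n; exact: vK.
move=> u bu hu k; have [hk _] := hu k.
apply: (@null_lim (fun n t => gmom_fun k t * (v n t * u t)) _
  (fun t => K * `|gmom_fun k t * u t|)).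
- by move=> n; exact: (hv n).2.
- by apply: L1_scale; exact: integrable_norm hk.
- by move=> n t; rewrite mulrCA normrM ler_wpM2r.
- move=> t; apply: cvgMr; apply: cvgMl; exact: vw.
Qed.

(** The partial sums of the exponential series are polynomials, which preserve [annihilated]. They
    are dominated by [expR (x * (t - a) ^ 2)], which [gmom_fun k] absorbs as soon as
    [x <= 1 / 4]. *)
Lemma multiplier_gauss x a : 0 <= x -> x <= 4^-1 ->
  multiplier (fun t => expR (- (x * (t - a) ^+ 2))).
Proof.
move=> x0 x4; split.
  exists 1 => t; rewrite ger0_norm ?expR_ge0// -expR0 ler_expR oppr_le0.
  by rewrite mulr_ge0// sqr_ge0.
move=> u [K hK] hu k.
have K0 : 0 <= K by exact: le_trans (hK 0).
pose g t := gmom_fun k t * (K * expR (0 * `|t| + (t - a) ^+ 2 / 4)).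
have lg : L1 g.
  apply: (@L1_gmomM _ _ _ K 0 a) => //.
    apply: measurable_funM => //; apply: measurableT_comp => //.
    apply: measurable_funD; first by apply: measurable_funM.
    by apply: measurable_funM => //; apply: measurable_funX; exact: measurable_funB.
  by move=> t; rewrite ger0_norm// mulr_ge0// expR_ge0.
apply: (@null_lim (fun n t => gmom_fun k t * (expsum n (- (x * (t - a) ^+ 2)) * u t))
  _ (fun t => `|g t|)).
- move=> n; elim: n => [|n IH].
    have := nullZ 0 (hu k); apply: null_ext => t.
    by rewrite /expsum big_ord0 !mul0r mulr0.
  have := nullD IH (annihilatedZ (n`!%:R^-1) (annihilated_quadratic x a n hu) k).
  by apply: null_ext => t; rewrite expsumS; ring.
- exact: integrable_norm lg.
- move=> n t; rewrite /g !normrM ler_wpM2l// mulrC ler_pM//.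
    by rewrite (ger0_norm K0).
  apply: le_trans (expsum_norm_le _ _) _.
  rewrite (ger0_norm (expR_ge0 _)) ler_expR normrN ger0_norm; last first.
    by rewrite mulr_ge0// sqr_ge0.
  by rewrite mul0r add0r mulrC ler_wpM2l// sqr_ge0.
- by move=> t; apply: cvgMr; apply: cvgMl; exact: expsum_cvg.
Qed.

(** By [power_threshold] the indicator is a bounded pointwise limit of polynomials in [v]. *)
Lemma multiplier_below_half v : (forall t, 0 <= v t <= 1) -> multiplier v ->
  multiplier (\1_[set t | v t < 1 / 2] : R -> R).
Proof.
move=> v01 hv.
apply: (@multiplier_lim (fun n t => (1 - v t ^+ n) ^+ (n * 2 ^ n)) _ 1).
- by move=> n; apply: multiplierXn; apply: multiplierC; exact: multiplierXn.
- move=> n t; have /andP[v0 v1] := v01 t.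
  have z0 : 0 <= 1 - v t ^+ n by rewrite subr_ge0 exprn_ile1.
  rewrite ger0_norm ?exprn_ge0// exprn_ile1//.
  by rewrite lerBlDr lerDl exprn_ge0.
- move=> t; have /andP[v0 v1] := v01 t.
  by rewrite indicE mem_setE; exact: power_threshold.
Qed.

Lemma multiplier_setC (A : set R) : multiplier (\1_A : R -> R) ->
  multiplier (\1_(~` A) : R -> R).
Proof.
move=> /multiplierC; apply: multiplier_ext => t.
by rewrite !indicE in_setC; case: (_ \in _); rewrite ?subr0 ?subrr.
Qed.

Lemma multiplier_bigcup (F : nat -> set R) :
  (forall n, multiplier (\1_(F n) : R -> R)) ->
  multiplier (\1_(\bigcup_n F n) : R -> R).
Proof.
move=> hF; rewrite -[X in \1_X]setCK; apply: multiplier_setC.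
(* These finite products decrease to the indicator of the complement of the union. *)
pose v n t : R := \prod_(i < n) (1 - \1_(F i) t).
have v1 n t : `|v n t| <= 1.
  rewrite /v; elim: n => [|n IH]; first by rewrite big_ord0 normr1.
  rewrite big_ord_recr/= normrM mulr_ile1// indicE.
  by case: (_ \in _); rewrite ?subr0 ?subrr ?normr0 ?normr1.
apply: (@multiplier_lim v _ 1) => //.
  move=> n; elim: n => [|n IH].
    by apply: multiplier_ext (multiplier_cst 1) => t; rewrite /v big_ord0.
  apply: multiplier_ext (multiplierM IH (multiplierC (hF n))) => t.
  by rewrite /v big_ord_recr.
move=> t; rewrite indicE in_setC.
have [|] := boolP (t \in \bigcup_n F n).
  rewrite inE => -[m _ Fm]; apply: cvg_near_cst; exists m.+1 => // n /= mn.
  by rewrite /v (bigD1 (Ordinal mn))//= indicE mem_set// subrr mul0r.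
move=> /negP; rewrite inE => nF; apply: cvg_near_cst; apply: nearW => n.
rewrite /v big1// => i _; rewrite indicE memNset ?subr0//.
by move=> Fi; apply: nF; exists i.
Qed.

(** With [x = ln 2 / r ^ 2] the Gaussian crosses [1 / 2] exactly at distance [r] from [a]; [r >= 2]
    and [ln 2 <= 1] ensure [x <= 1 / 4]. *)
Lemma multiplier_closed_ball a r : 2 <= r ->
  multiplier (\1_[set t | `|t - a| <= r] : R -> R).
Proof.
move=> r2; have r0 : 0 < r by lra.
have ln2_0 : 0 < ln (2 : R) by rewrite ln_gt0// ltr1n.
have ln2_1 : ln (2 : R) <= 1.
  rewrite -ler_expR lnK ?posrE//.
  by apply: le_trans (expR_ge1Dx 1); rewrite -natr1.
pose x : R := ln 2 / r ^+ 2.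
have x0 : 0 <= x by rewrite divr_ge0// ?exprn_ge0 1?ltW.
have x4 : x <= 4^-1.
  rewrite ler_pdivrMr ?exprn_gt0//.
  have : 4 <= r ^+ 2 by rewrite expr2; nra.
  by lra.
have e t : (expR (- (x * (t - a) ^+ 2)) < 1 / 2) = (r < `|t - a|).
  have -> : (1 / 2 : R) = expR (- ln 2) by rewrite expRN lnK ?posrE// div1r.
  rewrite ltr_expR ltrN2 /x mulrAC -mulrA ltr_pMr// ltr_pdivlMr ?exprn_gt0// mul1r.
  by rewrite -(real_normK (num_real (t - a))) ltr_pXn2r// nnegrE ltW.
have := multiplier_gauss a x0 x4 => /multiplier_below_half.
have -> : [set t | expR (- (x * (t - a) ^+ 2)) < 1 / 2] = ~` [set t | `|t - a| <= r].
  by apply/seteqP; split => t /=; rewrite e ltNge => /negP.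
move=> h; rewrite -[X in \1_X]setCK; apply: multiplier_setC; apply: h => t.
rewrite expR_ge0/= -expR0 ler_expR oppr_le0.
by rewrite mulr_ge0// sqr_ge0.
Qed.

Lemma multiplier_measurable (A : set (measurableTypeR R)) : measurable A ->
  multiplier (\1_A : R -> R).
Proof.
suff : (@ocitv R).-sigma.-measurable `<=` [set A | multiplier (\1_A : R -> R)].
  by apply.
rewrite RGenCInfty.measurableE; apply: smallest_sub.
  split => [|B hB|F hF] /=.
  - by apply: multiplier_ext (multiplier_cst 0) => t; rewrite indic0.
  - by rewrite setTD; exact: multiplier_setC.
  - exact: multiplier_bigcup.
move=> _ [x ->] /=.
(* Balls whose left end is [x] exhaust the ray; the offset in [n.+2] keeps every radius at least
   [2]. *)
have -> : `[x, +oo[%classic =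
    \bigcup_n [set t | `|t - (x + n.+2%:R)| <= n.+2%:R].
  apply/seteqP; split => t /=.
    rewrite in_itv/= andbT => xt; exists (Num.truncn (t - x)) => //=.
    have := truncnS_gt (t - x); move: (Num.truncn _) => m.
    have m0 := ler0n R m; rewrite ler_norml -!natr1 => mt.
    by apply/andP; split; lra.
  by move=> [n _ /=]; rewrite ler_norml in_itv/= andbT => /andP[h1 h2]; lra.
apply: multiplier_bigcup => n; apply: multiplier_closed_ball.
by rewrite ler_nat.
Qed.

Import HBSimple.

Lemma multiplier_sfun (s : {sfun measurableTypeR R >-> R}) :
  multiplier (fun t => s t).
Proof.
pose e : seq R := finmap.enum_fset (fset_set (range s)).
pose S n t := \sum_(i < n) e`_i * \1_(s @^-1` [set e`_i]) t.
suff hS n : multiplier (S n).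
  by apply: multiplier_ext (hS (size e)) => t; rewrite fimfunEord.
elim: n => [|n IH].
  by apply: multiplier_ext (multiplier_cst 0) => t; rewrite /S big_ord0.
have /multiplier_measurable hm : measurable (s @^-1` [set e`_n]).
  exact: measurable_sfunP.
apply: multiplier_ext (multiplierD IH (multiplierM (multiplier_cst _) hm)) => t.
by rewrite /S big_ord_recr.
Qed.

Hypothesis gmom0 : forall k, q (gmom R k) = 0.

(** Write [f = G h] with [h] measurable and approximate [h] by simple functions. These are
    multipliers, so their products with [G] are null, and [null_lim] passes to [f]. *)
Lemma gauss_moments_dense f (hf : L1 f) : q (toL1 hf) = 0.
Proof.
suff [h qh] : null f by rewrite -qh; congr (q _); exact: L1_ext.
have one : annihilated (fun=> 1).
  move=> k; apply: (@null_ext (gmom_fun k)); first by move=> t; rewrite mulr1.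
  by exists (L1_gmom R k); exact: gmom0.
pose G := gmom_fun 0 : R -> R.
have G0 t : 0 < G t by rewrite /G /gmom_fun expr0 mul1r expR_gt0.
pose h t := f t / G t.
have mf : measurable_fun setT (f : measurableTypeR R -> R).
  exact: (L1_measurable (toL1 hf)).
have mhR : measurable_fun setT (h : measurableTypeR R -> R).
  rewrite (_ : h = fun t => f t * expR (t ^+ 2)).
    by apply: measurable_funM => //; apply: measurableT_comp => //.
  by apply/funext => t; rewrite /h /G /gmom_fun expr0 mul1r expRN invrK.
have mh : measurable_fun setT (EFin \o h : measurableTypeR R -> \bar R).
  exact/measurable_EFinP.
have [s hs] := approximation_sfun measurableT mh.
have sh t : (fun n => s n t) @ \oo --> h t.
  by have /fine_cvgP[_] := hs t I.
(* Cutting off outside [A n] dominates the approximation by [2 |f|] once multiplied by [G]. Where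
   [h] is not zero the cut-off eventually does nothing; where [h] is zero it gives [0]. *)
pose A n := [set t : measurableTypeR R | `|s n t| <= 2 * `|h t|].
have mA n : measurable (A n).
  have m : measurable_fun setT (fun t : measurableTypeR R => 2 * `|h t| - `|s n t|).
    apply: measurable_funB; last exact: measurableT_comp.
    by apply: measurable_funM => //; exact: measurableT_comp.
  rewrite (_ : A n = setT `&` (fun t => 2 * `|h t| - `|s n t|) @^-1` `[0, +oo[).
    by apply: m => //; exact: measurable_itv.
  by rewrite setTI; apply/seteqP; split => t /=; rewrite in_itv/= andbT subr_ge0.
pose w n t := s n t * \1_(A n) t.
have wh n t : `|w n t| <= 2 * `|h t|.
  rewrite /w indicE; have [|_] := boolP (t \in A n); last first.
    by rewrite mulr0 normr0 mulr_ge0.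
  by rewrite inE mulr1.
have cw t : (fun n => w n t) @ \oo --> h t.
  have [h0|h0] := eqVneq (h t) 0.
    rewrite h0; apply: cvg_near_cst; apply: nearW => n.
    by apply/eqP; rewrite -normr_le0; apply: le_trans (wh n t) _; rewrite h0 normr0 mulr0.
  apply: cvg_trans (sh t); apply: near_eq_cvg.
  have h0' : 0 < `|h t| by rewrite normr_gt0.
  have /cvgrPdist_le/(_ _ h0') := sh t; apply: filterS => n hn.
  rewrite /w indicE mem_set ?mulr1//= /A /=.
  rewrite -(subrKC (h t) (s n t)); apply: le_trans (ler_normD _ _) _.
  by rewrite mulr_natl mulr2n lerD2l distrC.
apply: (@null_lim (fun n t => G t * w n t) f (fun t => 2 * `|f t|)).
- move=> n; have mw := multiplierM (multiplier_sfun (s n)) (multiplier_measurable (mA n)).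
  have := mw.2 _ (norm_bounded_cst 1) one 0; apply: null_ext => t.
  by rewrite mulr1.
- by apply: L1_scale; exact: integrable_norm hf.
- move=> n t; rewrite normrM (gtr0_norm (G0 t)).
  apply: le_trans (ler_wpM2l (ltW (G0 t)) (wh n t)) _.
  rewrite mulrCA ler_wpM2l// /h normrM normfV (gtr0_norm (G0 t)).
  by rewrite mulrC divfK// gt_eqF.
- move=> t; have -> : f t = G t * h t by rewrite /h mulrC divfK// gt_eqF.
  by apply: cvgMr; exact: cw.
Qed.

End Multipliers.

(** * The generators *)

Lemma L1_lincombE (R : realType) (I : Type) (v : I -> L1space R)
    (s : seq (R * I)) t :
  lincomb v s t = \sum_(p <- s) p.1 * v p.2 t.
Proof.
elim: s => [|p s IH]; first by rewrite /lincomb !big_nil.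
by rewrite big_cons -IH /lincomb big_cons.
Qed.

Lemma exists_small_power (R : realType) (r d : R) : 0 <= r -> r < 1 -> 0 < d ->
  exists M : nat, r ^+ M <= d.
Proof.
move=> r0 r1 d0; apply/not_existsP => h.
have : d <= 0; last by rewrite leNgt d0.
apply: (@geo_vanish _ _ 1 r) => // m; rewrite mul1r ltW// ltNge.
by apply/negP; exact: h.
Qed.

Theorem theorem4p2 (R : realType) (a : int -> R) (C r : R)
  (hC : 0 < C) (hr0 : 0 < r) (hr1 : r < 1)
  (ha : forall n : int, a n != 0 /\ `|a n| <= C * r ^+ (absz n)) :
  exists phi1 phi2 : R -> R,
    L1 phi1 /\ L1 phi2 /\ dense_translates phi1 phi2 (fun n : int => n%:~R + a n).
Proof.
(* With [rho <= 1 / 8], [4 * rho / (1 - rho) ^ 2] is at most [32 / 49]. *)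
have [M hM] : exists M : nat, r ^+ M <= 8^-1.
  by apply: exists_small_power; rewrite ?ltW ?invr_gt0.
pose rho := r ^+ M; pose c : R := M%:R; pose b n := a (M%:Z * n).
have rho0 : 0 <= rho by rewrite exprn_ge0// ltW.
have rho1 : rho < 1 by rewrite (le_lt_trans hM)// invf_lt1// ltr1n.
have hrho : 4 * (rho / (1 - rho) ^+ 2) < 1.
  have : 0 < 1 - rho by rewrite subr_gt0.
  move=> h; rewrite mulrA ltr_pdivrMr ?exprn_gt0// mul1r.
  by move: hM; rewrite -/rho expr2 => hM; nra.
have b0 n : b n != 0 by exact: (ha _).1.
have bC n : `|b n| <= C * rho ^+ `|n|%N.
  by apply: le_trans (ha _).2 _; rewrite abszM /rho -exprM.
have d0 j : 0 < (4^-1 : R) ^+ j by rewrite exprn_gt0// invr_gt0.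
have [tL htL] := choice (fun j => exists_resolvent_parameters (d0 j)).
have t0 j : 0 <= (tL j).1 by have [] := htL j.
have t1 j : (tL j).1 < 1 by have [] := htL j.
have tLd j : 2 * (1 - (tL j).1) + 2 * (tL j).1 ^+ (tL j).2 <= 4^-1 ^+ j.
  by have [] := htL j.
pose W s (hs : `|s| = 1) := @flat_limit R (L1space R) (L1sn R) (@L1_complete R)
  (shift_action c hs) tL t0 t1 tLd.
pose phi s (hs : `|s| = 1) : L1space R := W s hs 0 (gmom R 0).
pose phi1 := phi 1 (normr1 R); pose phi2 := phi (-1) (normrN1 R).
exists phi1, phi2; split; [exact: L1P|split; first exact: L1P].
pose v (p : bool * int) : L1space R :=
  L1shift (p.2%:~R + a p.2) (if p.1 then phi1 else phi2).
pose q := span_dist (L1sn R) v.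
have qN x : q x <= L1sn R x by exact: span_dist_le_sn.
(* For [s = 1] and [s = - 1] this makes the images of each moment under one minus and one plus the
   translation by [M] null. *)
have gen s (hs : `|s| = 1) :
    (forall n : int, q (L1shift (n%:~R * c + b n) (phi s hs)) = 0) ->
    forall k, q (gmom R k - s *: L1shift c (gmom R k)) = 0.
  move=> hq k.
  have h0 := flat_gmom_null qN rho0 rho1 hrho b0 bC hq k.
  have := flat_limit_generates qN h0 0.
  by rewrite act0 /= /shift_act expr1z mul1r.
have shiftE n : n%:~R * c + b n = (M%:Z * n)%:~R + a (M%:Z * n).
  by rewrite /b intrM mulrC.
have null1 k : q (gmom R k - 1 *: L1shift c (gmom R k)) = 0.
  apply: (gen 1 (normr1 R)) => n; rewrite shiftE.
  exact: (span_dist_gen (L1sn R) v (true, M%:Z * n)).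
have null2 k : q (gmom R k - (-1) *: L1shift c (gmom R k)) = 0.
  apply: (gen (-1) (normrN1 R)) => n; rewrite shiftE.
  exact: (span_dist_gen (L1sn R) v (false, M%:Z * n)).
have gmom0 k : q (gmom R k) = 0.
  apply: sn_eq0; rewrite -(ler_pM2l (ltr0Sn R 1)) mulr0.
  rewrite -[2%:R in leLHS]ger0_norm// -snZ.
  have -> : 2%:R *: gmom R k = (gmom R k - 1 *: L1shift c (gmom R k)) +
      (gmom R k - (-1) *: L1shift c (gmom R k)).
    by rewrite scale1r scaleN1r opprK addrACA addNr addr0 scaler_nat mulr2n.
  by apply: le_trans (snD _ _ _) _; rewrite null1 null2 addr0.
(* Every [g] is now at distance [0] from the span, so some combination comes within [eps]. *)
move=> g hg eps eps0.
have [s] := span_dist_adherent (L1sn R) v (toL1 hg) eps0.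
rewrite [span_dist_fun _ _ _](gauss_moments_dense qN gmom0 hg) add0r => hs.
exists [seq (p.1, p.2.1, p.2.2) | p <- s].
rewrite [ltLHS](_ : _ = (L1norm (toL1 hg - lincomb v s))%:E) ?lte_fin//.
rewrite -L1norm_EFin; apply: eq_integral => t _.
rewrite L1addE L1oppE L1_lincombE /transl_comb big_map /=.
congr (`|_ - _|%:E); apply: eq_bigr => -[x [[] n]] _ //=.
Qed.
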